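(* Let $n\geq 3$ and $3\leq r\leq n$, and let $P_{r,n,d}=\sum_{j=1}^r x_j^d$ be the truncated Pham polynomial, viewed as a polynomial on $\mathbb{R}^n$ with coordinates $(x_1,\dots,x_n)$. Let $\mathcal{F}$ be a real analytic codimension one singular foliation given in a neighborhood $U\subset\mathbb{R}^n$ of the origin $0\in\mathbb{R}^n$ by an integrable one-form $\omega = dP_{r,n,d}+P_{r,n,d}\,\tilde\omega$, where $\tilde\omega$ is a real analytic one-form. If $d=p^s$ for some prime number $p\in\mathbb{N}$ and some $s\in\mathbb{N}$, then $\mathcal{F}$ admits an analytic first integral in some neighborhood of the origin.
   Context: A one-form $\omega$ is integrable if $\omega\wedge d\omega=0$. An analytic first integral is a non-constant real analytic function $f$ defined in a neighborhood of the origin that is constant on the leaves of $\mathcal{F}$ (the leaves of the regular foliation $\omega=0$ off the zero set of $\omega$), i.e. $\omega\wedge df=0$. *)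

(* Defs.v *)
From HB Require Import structures.
From mathcomp Require Import all_boot all_order all_algebra.
From mathcomp Require Import all_classical all_reals all_analysis.

Set Implicit Arguments.
Unset Strict Implicit.
Unset Printing Implicit Defensive.

Import Order.TTheory GRing.Theory Num.Theory.
Import numFieldNormedType.Exports.

Local Open Scope classical_set_scope.
Local Open Scope ring_scope.

Definition monomial (R : realType) (n : nat) (x : 'rV[R]_n)
    (alpha : {ffun 'I_n -> nat}) : R :=
  \prod_(i < n) x ord0 i ^+ alpha i.

(* The sum of a family indexed by multi-indices is unordered: the family is
   absolutely summable, and its sum is the sum of its positive part minus the
   sum of its negative part. *)
Definition analytic_at (R : realType) (n : nat) (f : 'rV[R]_n -> R)
    (a : 'rV[R]_n) : Prop :=
  exists (c : {ffun 'I_n -> nat} -> R) (e : R), 0 < e /\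
    forall x, ball a e x ->
      let t := fun alpha => (c alpha * monomial (x - a) alpha)%:E in
      summable setT t /\
      (f x)%:E = (\esum_(alpha in setT) (t^\+)%E alpha
                - \esum_(alpha in setT) (t^\-)%E alpha)%E.

Definition analytic_on (R : realType) (n : nat) (A : set 'rV[R]_n)
    (f : 'rV[R]_n -> R) : Prop :=
  forall a, A a -> analytic_at f a.

(* A one-form w_1 dx_1 + ... + w_n dx_n is the field of its coefficient rows. *)
Definition one_form (R : realType) (n : nat) := 'rV[R]_n -> 'rV[R]_n.

Definition analytic_form_on (R : realType) (n : nat) (A : set 'rV[R]_n)
    (w : one_form R n) : Prop :=
  forall i : 'I_n, analytic_on A (fun x => w x ord0 i).

Definition partial (R : realType) (n : nat) (i : 'I_n) (f : 'rV[R]_n -> R)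
    (x : 'rV[R]_n) : R :=
  'D_(delta_mx ord0 i) (f : 'rV[R]_n -> R^o) x.

Definition diff0 (R : realType) (n : nat) (f : 'rV[R]_n -> R) : one_form R n :=
  fun x => \row_(i < n) partial i f x.

(* Two-forms are represented by the skew-symmetric matrix of their values on
   pairs of coordinate vectors, three-forms by their values on triples. *)
Definition diff1 (R : realType) (n : nat) (w : one_form R n) (x : 'rV[R]_n) :
    'M[R]_n :=
  \matrix_(i < n, j < n) (partial i (fun y => w y ord0 j) x
                        - partial j (fun y => w y ord0 i) x).

Definition wedge11 (R : realType) (n : nat) (u v : 'rV[R]_n) : 'M[R]_n :=
  \matrix_(i < n, j < n) (u ord0 i * v ord0 j - u ord0 j * v ord0 i).

Definition wedge12 (R : realType) (n : nat) (u : 'rV[R]_n) (M : 'M[R]_n)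
    (i j k : 'I_n) : R :=
  u ord0 i * M j k - u ord0 j * M i k + u ord0 k * M i j.

Definition integrable_form_on (R : realType) (n : nat) (A : set 'rV[R]_n)
    (w : one_form R n) : Prop :=
  forall x, A x -> forall i j k : 'I_n, wedge12 (w x) (diff1 w x) i j k = 0.

(* Non-constancy is that of the germ at the origin: V is not assumed to be
   connected, so non-constancy on V alone would admit locally constant
   functions. *)
Definition analytic_first_integral_on (R : realType) (n : nat)
    (V : set 'rV[R]_n) (w : one_form R n) (f : 'rV[R]_n -> R) : Prop :=
  [/\ analytic_on V f,
      ~ (\forall x \near (0 : 'rV[R]_n), f x = f 0) &
      forall x, V x -> wedge11 (w x) (diff0 f x) = 0].

(* Coordinates are numbered from 0, so x_1, ..., x_r are those with j < r. *)
Definition pham (R : realType) (r n d : nat) (x : 'rV[R]_n) : R :=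
  \sum_(j < n | (j < r)%N) x ord0 j ^+ d.

Definition pham_form (R : realType) (r n d : nat) (wt : one_form R n) :
    one_form R n :=
  fun x => diff0 (pham r d) x + pham r d x *: wt x.

(* Main.v *)
(* Let P be the truncated Pham polynomial and omega = dP + P theta.  Division of
   a 2-form by dP is a monomial Koszul homotopy: it is bounded for weighted l^1
   norms of power series, and it is exact because at least three variables occur
   in P.  As in Malgrange's proof of the singular Frobenius theorem, omega is
   unfolded into a nonsingular form dt + A, with one more variable t, where
   A = dP + C restricts to omega at t = 0.  Here C solves
       d/dt C = (dC - C /\ d/dt C) divided by dP,
   a fixed-point equation whose right-hand side is contracting for a filtration
   of the formal power series and preserves a ball of a weighted norm, so that
   the formal solution converges.  Integrability of omega at t = 0 propagates, by
   a Bianchi identity, to the flatness dA = A /\ d/dt A.  Radial integration then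
   yields a power series F with dF = (d/dt F) A, and f = F(., 0) satisfies
   df = g omega with g(0) = 1. *)
From HB Require Import structures.
From mathcomp Require Import all_boot all_order all_algebra.
From mathcomp Require Import all_classical all_reals all_analysis.
From mathcomp Require Import ring lra zify.
Require Import Defs.

Set Implicit Arguments.
Unset Strict Implicit.
Unset Printing Implicit Defensive.
Import Order.TTheory GRing.Theory Num.Theory.
Import numFieldNormedType.Exports.
Local Open Scope classical_set_scope.
Local Open Scope ring_scope.

(** * Multi-indices and formal power series *)

Section MultiIndex.
Variable I : finType.
Implicit Types a b c : {ffun I -> nat}.

(** Two losses have to be absorbed. Division by [dP] costs [m] degrees in [x], and [d/dx] is
    unbounded for geometric weights. The first loss is paid by [P], which vanishes to order [m+1],
    one more than its partial derivatives: this is where the form [dP + P theta] enters. The second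
    is paid by integration in [t]: with the extra weight [1/C(j+k,k)] on [x^j t^k], integration in
    [t] followed by [d/dx] is bounded, so a Cauchy-Kovalevskaya argument runs in one norm instead of
    a scale of norms. That weight alone makes division by [x^m] unbounded, and it is therefore
    averaged binomially over the degree in [x]. The equation for [C] is posed with a quotient
    defined for every 2-form, divisible or not. That the division is exact is proved afterwards, by
    induction on the order of the error [dA - A /\ d/dt A]: integrability handles its part without
    [t], the Bianchi identity the rest. *)

Definition unit_mi (i : I) : {ffun I -> nat} := [ffun j => nat_of_bool (j == i)].
Definition mi_le b a := [forall i, (b i <= a i)%N].
Definition mi_sub a b : {ffun I -> nat} := [ffun i => (a i - b i)%N].
Definition weight (w : I -> nat) a := (\sum_i w i * a i)%N.

Lemma miD a b i : (a + b) i = (a i + b i)%N.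
Proof. by rewrite ffunE. Qed.

Lemma mi0 i : (0 : {ffun I -> nat}) i = 0%N.
Proof. by rewrite ffunE. Qed.

Lemma unit_miE i j : unit_mi i j = (j == i).
Proof. by rewrite ffunE. Qed.

Lemma miMn a k i : (a *+ k) i = (a i * k)%N.
Proof. by elim: k => [|k IH]; rewrite ?mulr0n ?mi0 ?muln0// mulrS miD IH mulnS. Qed.

Lemma mi_leP b a : reflect (forall i, (b i <= a i)%N) (mi_le b a).
Proof. exact: forallP. Qed.

Lemma mi_le0 a : mi_le 0 a.
Proof. by apply/mi_leP => i; rewrite mi0. Qed.

Lemma mi_le_trans : transitive mi_le.
Proof.
by move=> b a c /mi_leP ab /mi_leP bc; apply/mi_leP => i; exact: leq_trans (bc i).
Qed.

Lemma mi_leDl a b : mi_le a (a + b).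
Proof. by apply/mi_leP => i; rewrite miD leq_addr. Qed.

Lemma mi_leDr a b : mi_le b (a + b).
Proof. by rewrite addrC mi_leDl. Qed.

Lemma mi_subK a b : mi_le b a -> mi_sub a b + b = a.
Proof. by move=> /mi_leP ba; apply/ffunP => i; rewrite miD ffunE subnK. Qed.

Lemma mi_subKr a b : mi_le b a -> b + mi_sub a b = a.
Proof. by move=> ba; rewrite addrC mi_subK. Qed.

Lemma mi_addK a b : mi_sub (a + b) b = a.
Proof. by apply/ffunP => i; rewrite ffunE miD addnK. Qed.

Lemma mi_addKl a b : mi_sub (a + b) a = b.
Proof. by rewrite addrC mi_addK. Qed.

Lemma mi_sub_le a b : mi_le (mi_sub a b) a.
Proof. by apply/mi_leP => i; rewrite ffunE leq_subr. Qed.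

Lemma mi_subn a : mi_sub a a = 0.
Proof. by rewrite -{1}[a]addr0 mi_addKl. Qed.

Lemma mi_addIr a : injective (fun b => b + a).
Proof. by move=> b c /(congr1 (mi_sub^~ a)); rewrite !mi_addK. Qed.

Lemma mi_addIl a : injective (fun b => a + b).
Proof. by move=> b c /(congr1 (mi_sub^~ a)); rewrite !mi_addKl. Qed.

Lemma mi_le_unit i a : mi_le (unit_mi i) a = (0 < a i)%N.
Proof.
apply/mi_leP/idP => [/(_ i)|ai j]; rewrite unit_miE ?eqxx//.
by case: eqP => [->|].
Qed.

Lemma weightD w a b : weight w (a + b) = (weight w a + weight w b)%N.
Proof. by rewrite /weight -big_split /=; apply: eq_bigr => i _; rewrite miD mulnDr. Qed.

Lemma weight0 w : weight w 0 = 0%N.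
Proof. by rewrite /weight big1// => i _; rewrite mi0 muln0. Qed.

Lemma weight_unit w i : weight w (unit_mi i) = w i.
Proof.
rewrite /weight (bigD1 i)//= unit_miE eqxx muln1 big1 ?addn0// => j /negPf ji.
by rewrite unit_miE ji muln0.
Qed.

Lemma weightMn w a k : weight w (a *+ k) = (weight w a * k)%N.
Proof. by elim: k => [|k IH]; rewrite ?mulr0n ?weight0 ?muln0//
  mulrS weightD IH mulnS. Qed.

Lemma leq_weight w i a : (0 < w i)%N -> (a i <= weight w a)%N.
Proof.
by move=> wi; rewrite /weight (bigD1 i)//= (leq_trans _ (leq_addr _ _))// leq_pmull.
Qed.

Lemma weight_sub w a b : mi_le b a -> weight w (mi_sub a b) =
  (weight w a - weight w b)%N.
Proof. by move=> ba; rewrite -{2}(mi_subK ba) weightD addnK. Qed.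

Lemma weight_le w a b : mi_le b a -> (weight w b <= weight w a)%N.
Proof. by move=> ba; rewrite -(mi_subK ba) weightD leq_addl. Qed.

Definition below a : seq {ffun I -> nat} :=
  [seq b <- [seq [ffun i => val (g i)] | g : {ffun I -> 'I_(weight (fun=> 1) a).+1}]
  | mi_le b a].

Lemma mem_below a b : (b \in below a) = mi_le b a.
Proof.
rewrite mem_filter andbC; case: (boolP (mi_le b a)) => [/mi_leP ba|];
  last by rewrite andbF.
rewrite andbT; apply/mapP.
have bnd i : (b i < (weight (fun=> 1) a).+1)%N.
  by rewrite ltnS (leq_trans (ba i))// leq_weight.
exists [ffun i => Ordinal (bnd i)]; first by rewrite mem_enum.
by apply/ffunP => i; rewrite !ffunE.
Qed.

Lemma below_uniq a : uniq (below a).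
Proof.
apply: filter_uniq; apply/injectiveP => f g /ffunP fg.
by apply/ffunP => i; apply: val_inj; have := fg i; rewrite !ffunE.
Qed.

Section BigBelow.
Variables (V : nmodType).
Implicit Type F : {ffun I -> nat} -> V.

Lemma big_below_shift a b F : mi_le b a ->
  \sum_(c <- below a | mi_le b c) F c = \sum_(c <- below (mi_sub a b)) F (c + b).
Proof.
move=> ba; rewrite -big_filter -(big_map (fun c => c + b) xpredT F).
apply: perm_big; apply: uniq_perm.
- by rewrite filter_uniq// below_uniq.
- by rewrite map_inj_uniq ?below_uniq//; exact: mi_addIr.
move=> c; rewrite mem_filter mem_below; apply/andP/mapP => [[bc ca]|[e]].
  exists (mi_sub c b); last by rewrite mi_subK.
  rewrite mem_below; apply/mi_leP => i; rewrite !ffunE leq_sub2r//; exact/mi_leP.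
rewrite mem_below => ea ->; rewrite mi_leDr; split=> //.
rewrite -(mi_subK ba); apply/mi_leP => i; rewrite !miD leq_add2r; exact/mi_leP.
Qed.

Lemma big_below_rev a F :
  \sum_(c <- below a) F c = \sum_(c <- below a) F (mi_sub a c).
Proof.
rewrite -(big_map (fun c => mi_sub a c) xpredT F); apply: perm_big.
have invo c : mi_le c a -> mi_sub a (mi_sub a c) = c.
  by move=> ca; rewrite -{1}(mi_subK ca) mi_addKl.
apply: uniq_perm; first exact: below_uniq.
  rewrite map_inj_in_uniq ?below_uniq// => c e; rewrite !mem_below => ca ea.
  by move=> /(congr1 (mi_sub a)); rewrite !invo.
move=> c; rewrite mem_below; apply/idP/mapP => [ca|[e _ ->]]; last exact: mi_sub_le.
by exists (mi_sub a c); rewrite ?mem_below ?mi_sub_le ?invo.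
Qed.

Lemma big_below_fst a F : (forall c, c != 0 -> mi_le c a -> F c = 0) ->
  \sum_(c <- below a) F c = F 0.
Proof.
move=> F0; rewrite (bigD1_seq 0) ?below_uniq ?mem_below ?mi_le0//=.
rewrite big_seq_cond big1 ?addr0// => c; rewrite mem_below => /andP[ca c0].
exact: F0.
Qed.

End BigBelow.
End MultiIndex.

Definition series (I : finType) (K : Type) := {ffun I -> nat} -> K.

Section SeriesRing.
Variables (I : finType) (K : comNzRingType).
Local Notation S := (series I K).
Implicit Types f g h : S.

HB.instance Definition _ := gen_eqMixin S.
HB.instance Definition _ := gen_choiceMixin S.

Definition ser_add f g : S := fun a => f a + g a.
Definition ser_opp f : S := fun a => - f a.
Definition ser_zero : S := fun=> 0.
Definition ser_one : S := fun a => (a == 0)%:R.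
Definition ser_mul f g : S :=
  fun a => \sum_(b <- below a) f b * g (mi_sub a b).

Let addA : associative ser_add.
Proof. by move=> f g h; apply/funext => a; rewrite /ser_add addrA. Qed.
Let addC : commutative ser_add.
Proof. by move=> f g; apply/funext => a; rewrite /ser_add addrC. Qed.
Let add0 : left_id ser_zero ser_add.
Proof. by move=> f; apply/funext => a; rewrite /ser_add add0r. Qed.
Let addN : left_inverse ser_zero ser_opp ser_add.
Proof. by move=> f; apply/funext => a; rewrite /ser_add /ser_opp addNr. Qed.

HB.instance Definition _ := GRing.isZmodule.Build S addA addC add0 addN.

Let mulC : commutative ser_mul.
Proof.
move=> f g; apply/funext => a; rewrite /ser_mul big_below_rev.
rewrite [LHS]big_seq [RHS]big_seq; apply: eq_bigr => b; rewrite mem_below => ba.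
by rewrite -{2}(mi_subK ba) mi_addKl mulrC.
Qed.

(** Both sides are sums over chains [c <= b <= a], where [b] is the degree of the partial product of
    [f] and [g]. *)
Let mulA : associative ser_mul.
Proof.
move=> f g h; apply/funext => a; rewrite /ser_mul.
transitivity (\sum_(c <- below a) \sum_(b <- below a | mi_le c b)
    f c * g (mi_sub b c) * h (mi_sub a b)).
  rewrite big_seq [RHS]big_seq; apply: eq_bigr => c; rewrite mem_below => ca.
  rewrite big_below_shift// mulr_sumr; apply: eq_bigr => b _.
  rewrite mulrA mi_addK; congr (_ * h _).
  by apply/ffunP => i; rewrite !ffunE /= subnDA subnAC.
rewrite (exchange_big_dep xpredT)//= [LHS]big_seq [RHS]big_seq.
apply: eq_bigr => b; rewrite mem_below => ba; rewrite mulr_suml -big_filter.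
apply: perm_big; apply: uniq_perm => [||c]; rewrite ?below_uniq//.
  by apply: filter_uniq; exact: below_uniq.
rewrite mem_filter !mem_below; case: (boolP (mi_le c b)) => //= cb.
exact: mi_le_trans ba.
Qed.

Let mul1 : left_id ser_one ser_mul.
Proof.
move=> f; apply/funext => a; rewrite /ser_mul big_below_fst.
  by rewrite /ser_one eqxx mul1r -{1}[a]addr0 mi_addK.
by move=> c /negPf c0 _; rewrite /ser_one c0 mul0r.
Qed.

Let mulDl : left_distributive ser_mul +%R.
Proof.
move=> f g h; apply/funext => a.
rewrite -[RHS]/(ser_mul f h a + ser_mul g h a) /ser_mul -big_split /=.
by apply: eq_bigr => b _; rewrite -mulrDl.
Qed.

Let one_neq0 : ser_one != 0.
Proof.
by apply/eqP => /(congr1 (fun f : S => f 0)); rewrite /ser_one eqxx => /eqP;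
  rewrite oner_eq0.
Qed.

HB.instance Definition _ :=
  GRing.Zmodule_isComNzRing.Build S mulA mulC mul1 mulDl one_neq0.

Lemma serD f g a : (f + g) a = f a + g a. Proof. by []. Qed.
Lemma serN f a : (- f) a = - f a. Proof. by []. Qed.
Lemma ser0 a : (0 : S) a = 0. Proof. by []. Qed.
Lemma ser1 a : (1 : S) a = (a == 0)%:R. Proof. by []. Qed.
Lemma serM f g a : (f * g) a = \sum_(b <- below a) f b * g (mi_sub a b).
Proof. by []. Qed.

Lemma ser_sum J (r : seq J) (P : pred J) (F : J -> S) a :
  (\sum_(j <- r | P j) F j) a = \sum_(j <- r | P j) F j a.
Proof. by elim/big_ind2: _ => // f x g y <- <-. Qed.

Lemma serMn f k a : (f *+ k) a = f a *+ k.
Proof. by elim: k => [|k IH]; rewrite ?mulr0n// !mulrS serD IH. Qed.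

Lemma ser_mulr_eq0 f g a : (forall b, mi_le b a -> f b * g (mi_sub a b) = 0) ->
  (f * g) a = 0.
Proof.
by move=> fg; rewrite serM big_seq big1// => b; rewrite mem_below; exact: fg.
Qed.

End SeriesRing.

(** * Derivations and orders of vanishing *)

Section Derivation.
Variables (I : finType) (K : comNzRingType).
Local Notation S := (series I K).
Implicit Types f g h : S.

Definition sderiv i f : S := fun a => f (a + unit_mi i) *+ (a i).+1.
Definition smono b : S := fun a => (a == b)%:R.

Lemma sderivD i f g : sderiv i (f + g) = sderiv i f + sderiv i g.
Proof. by apply/funext => a; rewrite /sderiv !serD mulrnDl. Qed.

Lemma sderivN i f : sderiv i (- f) = - sderiv i f.
Proof. by apply/funext => a; rewrite /sderiv !serN mulNrn. Qed.

Lemma sderivB i f g : sderiv i (f - g) = sderiv i f - sderiv i g.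
Proof. by rewrite sderivD sderivN. Qed.

Lemma sderiv0 i : sderiv i 0 = 0.
Proof. by apply/funext => a; rewrite /sderiv ser0 mul0rn. Qed.

Lemma sderiv_sum i J (r : seq J) (P : pred J) (F : J -> S) :
  sderiv i (\sum_(j <- r | P j) F j) = \sum_(j <- r | P j) sderiv i (F j).
Proof.
by elim/big_ind2 : _ => [|f f' g g' <- <-|]//; rewrite ?sderiv0 ?sderivD.
Qed.

(** For [b] below [a + unit_mi i], the factor [a i + 1] splits as [b i] plus the [i]-th entry of the
    complementary index. Each half vanishes where its factor is 0, which permits a shift by
    [unit_mi i]; the second half reduces to the first by reversing the summation. *)
Lemma sderivM i f g : sderiv i (f * g) = sderiv i f * g + f * sderiv i g.
Proof.
apply/funext => a; rewrite serD {1}/sderiv !serM -mulr_natl mulr_sumr.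
have ui : mi_le (unit_mi i) (a + unit_mi i) by rewrite mi_leDr.
transitivity (\sum_(b <- below (a + unit_mi i)) ((b i)%:R * (f b * g (mi_sub (a +
  unit_mi i) b)))
  + \sum_(b <- below (a + unit_mi i)) ((mi_sub (a +
    unit_mi i) b i)%:R * (f b * g (mi_sub (a + unit_mi i) b)))).
  rewrite -big_split /= [LHS]big_seq [RHS]big_seq; apply: eq_bigr => b.
  rewrite mem_below => ba; rewrite -mulrDl -natrD -miD mi_subKr// miD unit_miE eqxx.
  by rewrite addn1.
congr (_ + _).
  rewrite (bigID (mi_le (unit_mi i)))/= [X in _ + X]big1 ?addr0; last first.
    by move=> b; rewrite mi_le_unit -eqn0Ngt => /eqP ->; rewrite mul0r.
  rewrite big_below_shift// mi_addK; apply: eq_bigr => b _.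
  rewrite miD unit_miE eqxx addn1 /sderiv mulr_natl -mulrnAl; congr (_ * g _).
  by apply/ffunP => j; rewrite !ffunE/= subnDr.
rewrite big_below_rev [RHS]big_below_rev.
rewrite (bigID (mi_le (unit_mi i)))/= [X in _ + X]big1_seq ?addr0; last first.
  move=> b /andP[ib]; rewrite mem_below => ba.
  rewrite -{1}(mi_subK ba) mi_addKl; move: ib.
  by rewrite mi_le_unit -eqn0Ngt => /eqP ->; rewrite mul0r.
rewrite big_below_shift// mi_addK [LHS]big_seq [RHS]big_seq; apply: eq_bigr => b.
rewrite mem_below => ba; rewrite /sderiv.
have -> : mi_sub (a + unit_mi i) (b + unit_mi i) = mi_sub a b.
  by apply/ffunP => j; rewrite !ffunE/= subnDr.
have -> : mi_sub (a + unit_mi i) (mi_sub a b) = b + unit_mi i.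
  by rewrite -{1}(mi_subK ba) -addrA mi_addKl.
have -> : mi_sub a (mi_sub a b) = b by rewrite -{1}(mi_subK ba) mi_addKl.
by rewrite miD unit_miE eqxx addn1 mulr_natl mulrnAr.
Qed.

Lemma sderivC i j f : sderiv i (sderiv j f) = sderiv j (sderiv i f).
Proof.
apply/funext => a; rewrite /sderiv -!mulrnA addrAC; congr (_ *+ _).
rewrite !miD !unit_miE [i == j]eq_sym; case: eqP => [->|]; first by rewrite mulnC.
by rewrite !addn0 mulnC.
Qed.

Lemma smonoM b f a : (smono b * f) a = if mi_le b a then f (mi_sub a b) else 0.
Proof.
rewrite serM; case: ifPn => ba.
  rewrite (bigD1_seq b) ?below_uniq ?mem_below//= /smono eqxx mul1r.
  by rewrite big1 ?addr0// => c /negPf ->; rewrite mul0r.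
rewrite big_seq big1// => c; rewrite mem_below => ca; rewrite /smono.
by case: eqP => [cb|]; [move: ba; rewrite -cb ca | rewrite mul0r].
Qed.

Lemma smonoMD b f a : (smono b * f) (a + b) = f a.
Proof. by rewrite smonoM mi_leDr mi_addK. Qed.

Lemma smono0 : smono 0 = 1.
Proof. by []. Qed.

Lemma sderiv_smono_unit i j k :
  sderiv i (smono (unit_mi j *+ k.+1)) =
    if i == j then smono (unit_mi j *+ k) *+ k.+1 else 0.
Proof.
apply/funext => a; rewrite /sderiv /smono; case: (eqVneq i j) => [->|ij].
  rewrite serMn [unit_mi j *+ k.+1]mulrSr (inj_eq (@mi_addIr _ _)).
  by case: eqP => [->|]; rewrite ?mul0rn// miMn unit_miE eqxx mul1n.
rewrite ser0; case: eqP => [|]; last by rewrite mul0rn.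
by move=> /(congr1 (fun c : {ffun I -> nat} => c i));
  rewrite miD miMn !unit_miE eqxx (negPf ij) mul0n addn1.
Qed.

Lemma euler_coef f a i : (smono (unit_mi i) * sderiv i f) a = f a *+ a i.
Proof.
rewrite smonoM mi_le_unit; case: ifPn => ai.
  rewrite /sderiv mi_subK ?mi_le_unit//; congr (_ *+ _).
  by rewrite ffunE unit_miE eqxx subn1 prednK.
by move: ai; rewrite -eqn0Ngt => /eqP ->; rewrite mulr0n.
Qed.

(** The grading is a parameter: the unfolding uses a weighted degree in [x] and [t], radial
    integration the degree in [x] alone, and non-constancy the total degree. *)
Definition ord w k f := forall a, (weight w a < k)%N -> f a = 0.

Lemma ord_le w k l f : (k <= l)%N -> ord w l f -> ord w k f.
Proof. by move=> kl fl a ak; apply: fl; exact: leq_trans kl. Qed.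

Lemma ordD w k f g : ord w k f -> ord w k g -> ord w k (f + g).
Proof. by move=> fk gk a ak; rewrite serD fk ?gk ?addr0. Qed.

Lemma ordN w k f : ord w k f -> ord w k (- f).
Proof. by move=> fk a ak; rewrite serN fk ?oppr0. Qed.

Lemma ordB w k f g : ord w k f -> ord w k g -> ord w k (f - g).
Proof. by move=> fk gk; apply: ordD => //; exact: ordN. Qed.

Lemma ord_sum w k J (r : seq J) (P : pred J) (F : J -> S) :
  (forall j, P j -> ord w k (F j)) -> ord w k (\sum_(j <- r | P j) F j).
Proof. by move=> Fk; elim/big_ind : _ => //; exact: ordD. Qed.

Lemma ordM w k l f g : ord w k f -> ord w l g -> ord w (k + l) (f * g).
Proof.
move=> fk gl a akl; apply: ser_mulr_eq0 => b ba.
have [bk|bk] := ltnP (weight w b) k; first by rewrite fk ?mul0r.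
by rewrite gl ?mulr0// -(ltn_add2r (weight w b)) -weightD mi_subK//
  (leq_trans akl)// [(k + l)%N]addnC leq_add2l.
Qed.

Lemma ord_sderiv w k i f : ord w k f -> ord w (k - w i) (sderiv i f).
Proof.
move=> fk a ak; rewrite /sderiv fk ?mul0rn// weightD weight_unit.
by rewrite addnC -ltn_subRL.
Qed.

Lemma ord_smono w k b : (k <= weight w b)%N -> ord w k (smono b).
Proof.
move=> kb a ak; rewrite /smono; case: eqP => // ab.
by move: (leq_trans ak kb); rewrite ab ltnn.
Qed.

Lemma ord_eq0 w f : (forall k, ord w k f) -> f = 0.
Proof. by move=> f0; apply/funext => a; apply: (f0 (weight w a).+1). Qed.

End Derivation.

Section Reindex.
Variables (I J : finType) (K : comNzRingType).
Variables (c : {ffun I -> nat} -> K) (phi : {ffun I -> nat} -> {ffun J -> nat}).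

(** Division, remainder, integration in [t], lifting, restriction and radial inversion all have this
    shape, so that linearity, orders and norm bounds are proved once. *)
Definition sreindex (f : series J K) : series I K := fun a => c a * f (phi a).

Lemma sreindexD f g : sreindex (f + g) = sreindex f + sreindex g.
Proof. by apply/funext => a; rewrite /sreindex !serD mulrDr. Qed.

Lemma sreindexN f : sreindex (- f) = - sreindex f.
Proof. by apply/funext => a; rewrite /sreindex !serN mulrN. Qed.

Lemma sreindexB f g : sreindex (f - g) = sreindex f - sreindex g.
Proof. by rewrite sreindexD sreindexN. Qed.

Lemma sreindex0 : sreindex 0 = 0.
Proof. by apply/funext => a; rewrite /sreindex !ser0 mulr0. Qed.

Lemma ord_sreindex w w' k l f :
  (forall a, c a != 0 -> (weight w a < l)%N -> (weight w' (phi a) < k)%N) ->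
  ord w' k f -> ord w l (sreindex f).
Proof.
move=> cphi fk a al; rewrite /sreindex.
have [->|c0] := eqVneq (c a) 0; first by rewrite mul0r.
by rewrite fk ?mulr0//; exact: cphi.
Qed.

End Reindex.

(** * Division by the differential of the Pham polynomial *)

Section MonomialDivision.
Variables (J : finType) (R : realFieldType) (m : nat).
Local Notation S := (series J R).
Implicit Types (f g : S) (i j : J).

(** The derivative of [x_i^(m+1)]; the exponent [d] is written [m+1] throughout. *)
Definition dpow i : S := smono R (unit_mi i *+ m) *+ m.+1.
Definition squot i : S -> S :=
  sreindex (fun=> m.+1%:R^-1) (fun a => a + unit_mi i *+ m).
Definition srem i : S -> S := sreindex (fun a => (a i < m)%N%:R) id.

Lemma dpowME i f a : (dpow i * f) a =
  if (m <= a i)%N then f (mi_sub a (unit_mi i *+ m)) *+ m.+1 else 0.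
Proof.
rewrite /dpow mulrnAl serMn smonoM.
have -> : mi_le (unit_mi i *+ m) a = (m <= a i)%N.
  apply/mi_leP/idP => [/(_ i)|ma j]; rewrite miMn unit_miE; first by rewrite eqxx mul1n.
  by case: eqP => [->|_]; rewrite ?mul1n ?mul0n.
by case: ifP => //; rewrite mul0rn.
Qed.

Lemma squot_dpow i f : squot i (dpow i * f) = f.
Proof.
apply/funext => a; rewrite /squot /sreindex /dpow mulrnAl serMn smonoMD.
by rewrite -[f a *+ _]mulr_natl mulKf// pnatr_eq0.
Qed.

Lemma dpow_div i f : f = dpow i * squot i f + srem i f.
Proof.
apply/funext => a; rewrite serD dpowME /srem /sreindex ltnNge; case: ifPn => ma.
  rewrite mul0r addr0 /squot /sreindex mi_subK.
    by rewrite -[_ *+ m.+1]mulr_natl mulVKf// pnatr_eq0.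
  apply/mi_leP => j; rewrite miMn unit_miE.
  by case: eqP => [->|_]; rewrite ?mul1n ?mul0n.
by rewrite mul1r add0r.
Qed.

Lemma srem_dpow i f : srem i (dpow i * f) = 0.
Proof.
apply: (@addrI _ (dpow i * squot i (dpow i * f))).
by rewrite -dpow_div squot_dpow addr0.
Qed.

Lemma squot_srem i f : squot i (srem i f) = 0.
Proof.
apply/funext => a; rewrite /squot /srem /sreindex miD miMn unit_miE eqxx mul1n.
by rewrite ltnNge leq_addl mul0r mulr0.
Qed.

Lemma srem_id i f : srem i (srem i f) = srem i f.
Proof. by apply/funext => a; rewrite /srem /sreindex; case: ltnP;
  rewrite ?mul0r ?mul1r. Qed.

Lemma srem_comm i j f : srem i (srem j f) = srem j (srem i f).
Proof. by apply/funext => a; rewrite /srem /sreindex mulrCA. Qed.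

Lemma squot_dpow_neq i j f : i != j -> squot i (dpow j * f) = dpow j * squot i f.
Proof.
move=> ij; apply/funext => a; rewrite /squot /sreindex !dpowME miD miMn unit_miE.
rewrite eq_sym (negPf ij) mul0n addn0; case: ifP => mj; last by rewrite mulr0.
rewrite -mulrnAr; congr (_ * (f _ *+ _)).
apply/ffunP => k; rewrite [LHS]ffunE [RHS]miD [in RHS]ffunE !(miD, miMn, unit_miE).
case: (eqVneq k j) => [->|_]; last by rewrite mul0n !subn0.
by rewrite [j == i]eq_sym (negPf ij) mul0n !addn0.
Qed.

Lemma srem_dpow_neq i j f : i != j -> srem i (dpow j * f) = dpow j * srem i f.
Proof.
move=> ij; apply/funext => a; rewrite /srem /sreindex !dpowME.
rewrite ffunE miMn unit_miE (negPf ij) mul0n subn0.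
by case: ifP => _; rewrite ?mulr0// mulrnAr.
Qed.

Lemma sremD i f g : srem i (f + g) = srem i f + srem i g.
Proof. exact: sreindexD. Qed.
Lemma squotD i f g : squot i (f + g) = squot i f + squot i g.
Proof. exact: sreindexD. Qed.
Lemma sremN i f : srem i (- f) = - srem i f. Proof. exact: sreindexN. Qed.
Lemma squotN i f : squot i (- f) = - squot i f. Proof. exact: sreindexN. Qed.
Lemma srem0 i : srem i 0 = 0. Proof. exact: sreindex0. Qed.
Lemma squot0 i : squot i 0 = 0. Proof. exact: sreindex0. Qed.
End MonomialDivision.

(** * Koszul division of 2-forms by the differential of the Pham polynomial *)

Definition wedge12s (I : Type) (V : pzRingType) (u : I -> V) (T : I -> I -> V)
    i j k := u i * T j k - u j * T i k + u k * T i j.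

Section KoszulDivision.
Variables (J I : finType) (R : realFieldType) (m : nat) (v : I -> J).
Local Notation S := (series J R).
Variable y : I -> S.
Variables i1 i2 i3 : I.
Hypotheses (y1 : y i1 = dpow R m (v i1)) (y2 : y i2 = dpow R m (v i2))
  (y3 : y i3 = dpow R m (v i3)).
Hypotheses (n12 : i1 != i2) (n13 : i1 != i3) (n23 : i2 != i3).
Hypothesis y_cases : forall j, y j = 0 \/ y j = dpow R m (v j).
Hypothesis vI : injective v.
Variable G : I -> I -> S.
Hypothesis Gskew : forall i j, G i j = - G j i.

(* For G divisible by the form with coefficients y, this is the quotient: contract
   with the first coordinate vector and divide by y i1; the part of G i2 i1 that
   y i1 does not divide is divided by y i2 instead. *)
Definition kdiv j : S :=
  if j == i1 then srem m (v i1) (squot m (v i2) (G i2 i1)) else squot m (v i1) (G i1 j).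

Definition kerr i j := G i j - (y i * kdiv j - y j * kdiv i).
Local Notation T := kerr.
Local Notation E := (wedge12s y kerr).

Let Tskew i j : T i j = - T j i.
Proof. by rewrite /kerr Gskew; ring. Qed.

Let squot_y i j f : (y i = dpow R m (v i)) -> i != j ->
  squot m (v i) (y j * f) = y j * squot m (v i) f.
Proof.
move=> yi ij; have [->|->] := y_cases j; first by rewrite !mul0r squot0.
by rewrite squot_dpow_neq// (inj_eq vI).
Qed.

Let srem_y i j f : (y i = dpow R m (v i)) -> i != j ->
  srem m (v i) (y j * f) = y j * srem m (v i) f.
Proof.
move=> yi ij; have [->|->] := y_cases j; first by rewrite !mul0r srem0.
by rewrite srem_dpow_neq// (inj_eq vI).
Qed.

Let skew0 (F : I -> I -> S) : (forall i j, F i j = - F j i) -> forall i, F i i = 0.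
Proof.
move=> Fs i; apply/funext => a; have := congr1 (fun f : S => f a) (Fs i i).
by rewrite serN ser0; lra.
Qed.

(** In row [i1] the quotients by [y i1] have been taken out by [kdiv], so that remainders modulo
    [y i1] are all that is left. *)
Let T1E k : T i1 k = srem m (v i1) (G i1 k - y k * squot m (v i2) (G i1 i2)).
Proof.
have [->|k1] := eqVneq k i1.
  by rewrite (skew0 Tskew) (skew0 Gskew) add0r y1 sremN srem_dpow oppr0.
rewrite /kerr /kdiv eqxx (negPf k1) y1 {1}(dpow_div m (v i1) (G i1 k)).
rewrite sremD sremN srem_y// 1?eq_sym// [G i2 i1]Gskew squotN sremN; ring.
Qed.

Let T12E : T i1 i2 = srem m (v i1) (srem m (v i2) (G i1 i2)).
Proof. by rewrite T1E y2 {1}(dpow_div m (v i2) (G i1 i2));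
  rewrite addrAC subrr add0r. Qed.

(** Since [y /\ y = 0], [E] equals [y /\ G]: the three residue lemmas express the error through the
    obstruction to divisibility. Here the quotient of [E i1 k l] by [y i1] keeps [T k l] and kills
    the terms from row [i1], which are remainders. *)
Lemma koszul_residue (k l : I) : k != i1 -> l != i1 -> T k l =
  squot m (v i1) (E i1 k l).
Proof.
move=> k1 l1; rewrite /wedge12s squotD squotD squotN.
rewrite y1 squot_dpow -?y1 !squot_y// 1?eq_sym//.
by rewrite !T1E !squot_srem !mulr0 subr0 addr0.
Qed.

(** In [E i1 i2 k] the remainder modulo [y i1] removes [T i2 k]; the quotient by [y i2] then removes
    [T i1 i2], itself a remainder modulo [y i2]. *)
Lemma koszul_residue1 k : k != i1 -> k != i2 ->
  T i1 k = - squot m (v i2) (srem m (v i1) (E i1 i2 k)).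
Proof.
move=> k1 k2; rewrite /wedge12s !sremD !sremN y1 srem_dpow sub0r -?y1.
rewrite !srem_y// 1?eq_sym// squotD squotN y2 squot_dpow -?y2.
have -> : srem m (v i1) (T i1 i2) = T i1 i2 by rewrite T12E srem_id.
by rewrite squot_y// 1?eq_sym// T12E srem_comm squot_srem mulr0 addr0 opprK T1E srem_id.
Qed.

(** The third variable enters here: in [E i1 i2 i3], remainders modulo [y i1] and [y i2] leave only
    [y i3 * T i1 i2]. *)
Lemma koszul_residue12 :
  T i1 i2 = squot m (v i3) (srem m (v i2) (srem m (v i1) (E i1 i2 i3))).
Proof.
rewrite /wedge12s !sremD !sremN y1 srem_dpow -?y1 (srem_y _ y1 n12) (srem_y _ y1 n13).
rewrite srem0 sub0r y2 srem_dpow -?y2 oppr0 add0r (srem_y _ y2 n23).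
by rewrite y3 squot_dpow T12E srem_id [RHS]srem_comm srem_id.
Qed.

End KoszulDivision.

(** * Flatness of the unfolding *)

Section Unfolding.
Variables (I : finType) (R : realFieldType) (m : nat) (pr : pred I).
Local Notation J := (option I).
Local Notation S := (series J R).
Local Notation D i := (sderiv (Some i)).
Local Notation Dt := (sderiv (None : J)).

Definition spham : S := \sum_(i | pr i) smono R (unit_mi (Some i) *+ m.+1).

(* Division by dP lowers the degree in x by m and d/dx by 1; the weight m + 2 of t
   makes the integration in t more than compensate for both. *)
Definition uweight (j : J) : nat := if j is Some _ then 1 else m.+2.

Lemma sderiv_spham i : D i spham = if pr i then dpow R m (Some i) else 0.
Proof.
rewrite /spham sderiv_sum; case: ifPn => pri.
  rewrite (bigD1 i)//= sderiv_smono_unit eqxx big1 ?addr0// => j /andP[_ ji].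
  rewrite sderiv_smono_unit; case: eqP => // -[ij]; by rewrite ij eqxx in ji.
rewrite big1// => j prj; rewrite sderiv_smono_unit; case: eqP => // -[ij].
by rewrite ij prj in pri.
Qed.

Lemma sderivt_spham : Dt spham = 0.
Proof. by rewrite /spham sderiv_sum big1// => i _; rewrite sderiv_smono_unit. Qed.

Lemma ord_spham w k : (forall i, (k <= w (Some i) * m.+1)%N) -> ord w k spham.
Proof.
by move=> wk; apply: ord_sum => i _; apply: ord_smono; rewrite weightMn weight_unit.
Qed.

Variables (i1 i2 i3 : I).
Hypotheses (pr1 : pr i1) (pr2 : pr i2) (pr3 : pr i3).
Hypotheses (n12 : i1 != i2) (n13 : i1 != i3) (n23 : i2 != i3).
Variables (C X : I -> S).
Let y i := D i spham.
Let A i := y i + C i.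
Definition unf_rhs (C X : I -> S) i j :=
  D i (C j) - D j (C i) - (C i * X j - C j * X i).
Hypothesis DtC : forall i, Dt (C i) = X i.
Hypothesis XE : forall i, X i = kdiv m Some i1 i2 (unf_rhs C X) i.
Hypothesis ordC : forall i, ord uweight m.+1 (C i).
Hypothesis int0 : forall i j k (a : {ffun J -> nat}), a None = 0%N ->
  wedge12s A (fun i j => D i (A j) - D j (A i)) i j k a = 0.

(** The division error of the fixed-point equation. As [dP] is closed, it is also the defect of
    flatness [dA - A /\ X]. *)
Let T i j := unf_rhs C X i j - (y i * X j - y j * X i).

Let DtA i : Dt (A i) = X i.
Proof. by rewrite /A sderivD /y sderivC sderivt_spham sderiv0 add0r DtC. Qed.

Let Dy i j : D i (y j) = D j (y i).
Proof. exact: sderivC. Qed.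

Let TE i j : T i j = D i (A j) - D j (A i) - (A i * X j - A j * X i).
Proof. by rewrite /T /unf_rhs /A !sderivD (Dy i j); ring. Qed.

Let wedge_T i j k :
  wedge12s A T i j k = wedge12s A (fun i j => D i (A j) - D j (A i)) i j k.
Proof. by rewrite /wedge12s !TE; ring. Qed.

(** Both sides equal [A /\ dX]: substitute [T = dA - A /\ X] and [d/dt A = X], and use [A /\ A = 0]
    and [X /\ X = 0]. *)
Let bianchi i j k : wedge12s A (fun i j => Dt (T i j)) i j k =
  D i (T j k) - D j (T i k) + D k (T i j) + wedge12s X T i j k.
Proof.
rewrite /wedge12s !TE !(sderivB, sderivM) ![Dt (D _ _)]sderivC !DtA.
rewrite (sderivC (Some j) (Some i)) (sderivC (Some k) (Some i)) (sderivC (Some k) (Some j)).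
by ring.
Qed.

Let ord_wedge (u : I -> S) (Th : I -> I -> S) k l i1' i2' i3' :
  (forall i, ord uweight k (u i)) -> (forall i j, ord uweight l (Th i j)) ->
  ord uweight (k + l) (wedge12s u Th i1' i2' i3').
Proof. by move=> uk Tl; apply: ordD; [apply: ordB|]; apply: ordM. Qed.

(** [y /\ T] has order [N + m] for free; the content is that the coefficients of weight exactly
    [N + m] reached by division vanish too. *)
Let resid_vanish N i j k a l : (forall i j, ord uweight N (T i j)) ->
  weight uweight a = N -> wedge12s y T i j k (a + unit_mi (Some l) *+ m) = 0.
Proof.
move=> IH wa; set c := a + _.
have wc : weight uweight c = (N + m)%N.
  by rewrite weightD wa weightMn weight_unit mul1n.
have [c0|c0] := posnP (c None).
  (* [C] has order [m+1], so [C /\ T] starts beyond weight [N + m], and [y /\ T] has the same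
     coefficient here as [A /\ T], which is [A /\ dA]. *)
  have : wedge12s A T i j k c = 0 by rewrite wedge_T int0.
  have -> : wedge12s A T i j k = wedge12s y T i j k + wedge12s C T i j k.
    by rewrite /wedge12s /A; ring.
  rewrite serD [wedge12s C T i j k c](@ord_wedge _ _ m.+1 N) ?addr0//.
  by rewrite wc addnC ltn_add2r.
pose e := unit_mi (None : J).
have ec : mi_le e c by rewrite mi_le_unit.
(* Makes the truncated subtraction [N - m.+2] exact: [t] divides the monomial of [a] and has weight
   [m+2]. *)
have NN : (m.+2 <= N)%N.
  have ea : mi_le e a by move: c0; rewrite mi_le_unit miD miMn unit_miE mul0n addn0.
  by rewrite -wa (leq_trans _ (weight_le uweight ea))// weight_unit.
have Dty h : Dt (wedge12s y h i j k) = wedge12s y (fun i j => Dt (h i j)) i j k.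
  have Dty0 n : Dt (y n) = 0 by rewrite /y sderivC sderivt_spham sderiv0.
  by rewrite /wedge12s sderivD sderivB !sderivM !Dty0; ring.
have : Dt (wedge12s y T i j k) (mi_sub c e) = 0.
  rewrite Dty.
  have -> : wedge12s y (fun i j => Dt (T i j)) i j k =
     D i (T j k) - D j (T i k) + D k (T i j) + wedge12s X T i j k
     - wedge12s C (fun i j => Dt (T i j)) i j k.
    by rewrite -bianchi /wedge12s /A; ring.
  have wce : weight uweight (mi_sub c e) = (N + m - m.+2)%N.
    by rewrite weight_sub// wc weight_unit.
  (* Removing one [t] leaves weight [N - 2], whereas an [x]-derivative of [T] has order [N - 1] and
     [C /\ d/dt T] has order [(m+1) + N - (m+2)]. The weight [m+2] of [t] is what leaves this
     gap. *)
  suff : ord uweight (N - 1) (D i (T j k) - D j (T i k) + D k (T i j) +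
      wedge12s X T i j k - wedge12s C (fun i j => Dt (T i j)) i j k).
    by apply; rewrite wce; lia.
  have oD n f : ord uweight N f -> ord uweight (N - 1) (D n f).
    exact: (@ord_sderiv _ _ uweight N (Some n)).
  have oDt f : ord uweight N f -> ord uweight (N - m.+2) (Dt f).
    exact: (@ord_sderiv _ _ uweight N None).
  apply: ordB; first apply: ordD.
  - by apply: ordD; [apply: ordB|]; apply: oD.
  - by apply: (@ord_le _ _ _ _ (0 + N)); [rewrite add0n leq_subr|apply: ord_wedge].
  - apply: (@ord_le _ _ _ _ (m.+1 + (N - m.+2))); first by lia.
    by apply: ord_wedge => // i' j'; apply: oDt.
by rewrite /sderiv mi_subK// => /eqP; rewrite mulrn_eq0 /= => /eqP.
Qed.

Let y_cases i : y i = 0 \/ y i = dpow R m (Some i).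
Proof. by rewrite /y sderiv_spham; case: ifP; [right|left]. Qed.

Let yE i : pr i -> y i = dpow R m (Some i).
Proof. by rewrite /y sderiv_spham => ->. Qed.

Let rhs_skew i j : unf_rhs C X i j = - unf_rhs C X j i.
Proof. by rewrite /unf_rhs; ring. Qed.

(** Induction on the weight: the residue lemmas read the coefficient of [T] at [a] off coefficients
    of [y /\ T] at [a] shifted by [m] in one of the variables [i1], [i2], [i3], and [resid_vanish]
    kills those. *)
Let T_vanish N : forall i j, ord uweight N (T i j).
Proof.
elim: N => [//|N IH] i j a; rewrite ltnS leq_eqVlt => /orP[/eqP wa|]; last exact: IH.
have TK k l : T k l = unf_rhs C X k l - (y k * kdiv m Some i1 i2 (unf_rhs C X) l
    - y l * kdiv m Some i1 i2 (unf_rhs C X) k) by rewrite /T -!XE.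
have sinj : injective (@Some I) by move=> ? ? [].
have TN k l : T k l = - T l k by rewrite /T (rhs_skew k l); ring.
have TE' : T = kerr m Some y i1 i2 (unf_rhs C X).
  by apply/funext => k; apply/funext => l; exact: TK.
have E0 k l n p : wedge12s y T k l n (a + unit_mi (Some p) *+ m) = 0.
  exact: resid_vanish wa.
have T12 : T i1 i2 a = 0.
  rewrite TE' (koszul_residue12 (yE pr1) (yE pr2) (yE pr3))// -TE'.
  by rewrite /squot /srem /sreindex /= E0 !mulr0.
have T1 k : k != i1 -> T i1 k a = 0.
  move=> k1; have [->//|k2] := eqVneq k i2.
  rewrite TE' (koszul_residue1 (yE pr1) (yE pr2))// -TE' serN.
  by rewrite /squot /srem /sreindex /= E0 !mulr0 oppr0.
have [->|ni] := eqVneq i i1; have [->|nj] := eqVneq j i1.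
- by have := congr1 (fun f : S => f a) (TN i1 i1); rewrite serN; lra.
- exact: T1.
- by rewrite TN serN T1 ?oppr0.
- rewrite TE' (koszul_residue _ (yE pr1))// -TE'.
  by rewrite /squot /sreindex /= E0 mulr0.
Qed.

Lemma unfolding_flat i j : D i (A j) - D j (A i) = A i * X j - A j * X i.
Proof.
apply/eqP; rewrite -subr_eq0; apply/eqP; rewrite -TE.
by apply: (@ord_eq0 _ _ uweight) => N; exact: T_vanish.
Qed.

End Unfolding.

(** * Radial integration of a flat form *)

Lemma big_option (V : nmodType) (I : finType) (F : option I -> V) :
  \sum_j F j = F None + \sum_i F (Some i).
Proof.
rewrite (bigD1 None)//=; congr (_ + _).
by rewrite (reindex_omap Some id)//=; [apply: eq_bigl => i; rewrite eqxx|case].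
Qed.

Section RadialIntegration.
Variables (I : finType) (R : realFieldType).
Local Notation J := (option I).
Local Notation S := (series J R).
Local Notation D i := (sderiv (Some i)).
Local Notation Dt := (sderiv (None : J)).
Local Notation x i := (smono R (unit_mi (Some i : J))).

Definition xweight (j : J) : nat := if j is Some _ then 1 else 0.

(* The constant term in x is sent to 0, since 0^-1 = 0. *)
Definition rinv : S -> S := sreindex (fun a => (weight xweight a)%:R^-1) id.

Definition euler (f : S) : S := \sum_i x i * D i f.

Lemma eulerE f a : euler f a = f a *+ weight xweight a.
Proof.
rewrite /euler ser_sum /weight big_option /= mul0n.
rewrite -[RHS]/(f a *+ (0 + \sum_i 1 * a (Some i))) add0n -sumrMnr.
by apply: eq_bigr => i _; rewrite euler_coef mul1n.
Qed.

Lemma euler_rinv f : ord xweight 1 f -> euler (rinv f) = f.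
Proof.
move=> f1; apply/funext => a; rewrite eulerE /rinv /sreindex -mulrnAl.
have [a0|a0] := posnP (weight xweight a); first by rewrite a0 mulr0n mul0r f1// a0.
by rewrite -mulr_natr mulVf ?mul1r// pnatr_eq0 -lt0n.
Qed.

Variables A : I -> S.
Hypothesis flat : forall i j, D i (A j) - D j (A i) = A i * Dt (A j) - A j * Dt (A i).

(** The contraction of the form [A] with the Euler field. *)
Definition radial : S := \sum_i x i * A i.

Lemma ord_radial f : ord xweight 1 (radial * f).
Proof.
rewrite -[1%N]addn0; apply: ordM => //; apply: ord_sum => i _.
by rewrite -[1%N]addn0; apply: ordM => //; apply: ord_smono; rewrite weight_unit.
Qed.

Variable F : S.
Hypothesis transport : euler F = radial * Dt F.

(** These fields span the kernel of [dt + A]; flatness says that they commute, and first integrals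
    are the functions that they all annihilate. *)
Let V i f := D i f - A i * Dt f.

Let Vcomm i j f : V i (V j f) = V j (V i f).
Proof.
rewrite /V !(sderivB, sderivM) ![Dt (D _ _)]sderivC (sderivC (Some j) (Some i)).
have /eqP := flat i j; rewrite subr_eq => /eqP ->.
by ring.
Qed.

Let Vx i f g : V i (f * g) = V i f * g + f * V i g.
Proof. by rewrite /V !sderivM; ring. Qed.

Let V_sum j (G : I -> S) : V j (\sum_i G i) = \sum_i V j (G i).
Proof. by rewrite /V !sderiv_sum mulr_sumr -sumrB. Qed.

Let Wsum f : euler f - radial * Dt f = \sum_i x i * V i f.
Proof.
rewrite /euler /radial mulr_suml -sumrB; apply: eq_bigr => i _.
by rewrite /V mulrBr mulrA.
Qed.

(** Only the radial combination of the [V i F] is known to vanish. Applying [V j] to it gives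
    [g + euler g = radial * Dt g] for [g = V j F]. The operator [1 + euler] multiplies each
    coefficient by a positive integer and [radial] raises the order in [x], so [g] has infinite
    order. *)
Lemma frobenius_transport j : D j F = A j * Dt F.
Proof.
apply/eqP; rewrite -subr_eq0; apply/eqP; rewrite -/(V j F).
set g := V j F.
have gE : g + euler g = radial * Dt g.
  apply/eqP; rewrite -subr_eq0 -addrA Wsum; apply/eqP.
  have : V j (\sum_i x i * V i F) = 0.
    by rewrite -Wsum transport subrr /V !sderiv0 mulr0 subr0.
  rewrite V_sum (eq_bigr (fun i => (V j (x i)) * V i F + x i * V i g)); last first.
    by move=> i _; rewrite Vx (Vcomm j i).
  rewrite big_split /= => H; rewrite -[RHS]H; congr (_ + _).
  have Vxi i : V j (x i) = (i == j)%:R.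
    rewrite /V -[unit_mi _]mulr1n !sderiv_smono_unit /= mulr0 subr0 mulr0n.
    case: (eqVneq i j) => [->|ij]; first by rewrite eqxx.
    by case: eqP => // -[ji]; rewrite ji eqxx in ij.
  rewrite (bigD1 j)//= Vxi eqxx mul1r big1 ?addr0// => i /negPf ij.
  by rewrite Vxi ij mul0r.
suff : forall N, ord xweight N g by exact: ord_eq0.
elim=> [//|N IH] a; rewrite ltnS => aN.
have : (g + euler g) a = 0.
  rewrite gE /radial mulr_suml ser_sum big1// => i _; rewrite -mulrA smonoM.
  case: ifPn => // ia.
  have NAg : ord xweight (0 + N) (A i * Dt g).
    apply: ordM => //; rewrite -[N]subn0.
    exact: (@ord_sderiv _ _ xweight N None).
  apply: NAg; have := weight_le xweight ia.
  by rewrite weight_sub// weight_unit /= add0n; move: aN; lia.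
by rewrite serD eulerE -mulrS => /eqP; rewrite mulrn_eq0 /= => /eqP.
Qed.

End RadialIntegration.

(** * Fixed points and weighted norms *)

Section FixedPoint.
Variables (J : finType) (K : comNzRingType) (T : Type) (w : J -> nat).
Local Notation S := (series J K).
Variable Phi : (T -> S) -> T -> S.
Hypothesis contr : forall N (X Y : T -> S),
  (forall i, ord w N (X i - Y i)) -> forall i, ord w N.+1 (Phi X i - Phi Y i).

Let it N := iter N Phi (fun=> 0).

Let ord_it N M i : (N <= M)%N -> ord w N (it M i - it N i).
Proof.
elim: N M i => [//|N IH] [//|M] i NM; rewrite /it !iterS.
by apply: contr => k; exact: IH.
Qed.

(** The coefficient at [a] is stationary along the iterates from step [weight w a + 1] on, and the
    fixed point collects these values. The second clause transfers norm bounds from the iterates to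
    the fixed point. *)
Lemma series_fixpoint : exists X : T -> S, (forall i, Phi X i = X i) /\
  forall N i, ord w N (X i - iter N Phi (fun=> 0) i).
Proof.
pose X : T -> S := fun i a => it (weight w a).+1 i a.
have XN N i : ord w N (X i - it N i).
  move=> a aN; have := @ord_it _ _ i aN a; rewrite ltnS leqnn => /(_ isT).
  rewrite !serD !serN /X => /eqP; rewrite subr_eq0 => /eqP ->.
  by rewrite subrr.
exists X; split=> // i; apply/eqP; rewrite -subr_eq0; apply/eqP.
suff : forall N, ord w N (Phi X i - X i) by exact: ord_eq0.
case=> [//|N].
have -> : Phi X i - X i = (Phi X i - Phi (it N) i) - (X i - it N.+1 i).
  by rewrite /it iterS; ring.
by apply: ordB => //; apply: contr => k; exact: XN.
Qed.

End FixedPoint.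

Section WeightedNorm.
Variables (J : finType) (R : realFieldType).
Local Notation S := (series J R).
Implicit Types (W : {ffun J -> nat} -> R) (f g : S) (M : R).

(* A bound on the weighted l^1 norm, on finite sums so that no summability is
   presupposed. *)
Definition bnd W f M := forall s, uniq s -> \sum_(a <- s) `|f a| * W a <= M.

Lemma bnd_ge0 W f M : bnd W f M -> 0 <= M.
Proof. by move=> /(_ [::] isT); rewrite big_nil. Qed.

Lemma bnd_le W f M M' : M <= M' -> bnd W f M -> bnd W f M'.
Proof. by move=> MM' fM s us; exact: le_trans (fM _ us) MM'. Qed.

Lemma bnd_leW W W' f M : (forall a, W a <= W' a) -> bnd W' f M -> bnd W f M.
Proof.
move=> WW fM s us; apply: le_trans (fM _ us).
by apply: ler_sum => a _; rewrite ler_wpM2l.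
Qed.

(** A finite sum sees only finitely many weights, so an approximation of sufficiently high order has
    the same sum. *)
Lemma bnd_approx W w f M :
  (forall N, exists g, ord w N (f - g) /\ bnd W g M) -> bnd W f M.
Proof.
move=> fg s us; have [g [og gM]] := fg (\max_(a <- s) weight w a).+1.
apply: le_trans (gM _ us); rewrite le_eqVlt big_seq [X in _ == X]big_seq.
apply/orP; left; apply/eqP; apply: eq_bigr => a sa.
have : (f - g) a = 0 by apply: og; rewrite ltnS (leq_bigmax_seq a).
by rewrite serD serN => /eqP; rewrite subr_eq0 => /eqP ->.
Qed.

Section Rules.
Variable W : {ffun J -> nat} -> R.
Hypothesis W_ge0 : forall a, 0 <= W a.

Lemma bnd0 : bnd W 0 0.
Proof. by move=> s _; rewrite big1// => a _; rewrite ser0 normr0 mul0r. Qed.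

Lemma bndD f g M N : bnd W f M -> bnd W g N -> bnd W (f + g) (M + N).
Proof.
move=> fM gN s us; apply: le_trans (lerD (fM _ us) (gN _ us)).
rewrite -big_split; apply: ler_sum => a _ /=.
by rewrite -mulrDl ler_wpM2r// serD ler_normD.
Qed.

Lemma bndN f M : bnd W f M -> bnd W (- f) M.
Proof.
move=> fM s us; apply: le_trans (fM _ us).
by apply: ler_sum => a _; rewrite serN normrN.
Qed.

Lemma bndB f g M N : bnd W f M -> bnd W g N -> bnd W (f - g) (M + N).
Proof. by move=> fM gN; apply: bndD => //; exact: bndN. Qed.

Lemma bnd_sum I (r : seq I) (P : pred I) (F : I -> S) (M : I -> R) :
  (forall i, P i -> bnd W (F i) (M i)) ->
  bnd W (\sum_(i <- r | P i) F i) (\sum_(i <- r | P i) M i).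
Proof. by move=> FM; elim/big_rec2 : _ => [|i f M' Pi IH];
  [exact: bnd0|apply: bndD; auto]. Qed.

Lemma bnd_smono b : bnd W (smono R b) (W b).
Proof.
move=> s us; have [bs|bs] := boolP (b \in s).
  rewrite (bigD1_seq b)//= /smono eqxx normr1 mul1r big1 ?addr0// => a /negPf ->.
  by rewrite normr0 mul0r.
rewrite big_seq big1 ?W_ge0// => a sa; rewrite /smono; case: eqP => [ab|_].
  by rewrite -ab sa in bs.
by rewrite normr0 mul0r.
Qed.

Hypothesis W_submul : forall a b, W (a + b) <= W a * W b.

Lemma bndM f g M N : bnd W f M -> bnd W g N -> bnd W (f * g) (M * N).
Proof.
(* One list containing every index below an element of [s], so that the two summations can be
   exchanged. *)
move=> fM gN s us; pose t := undup (flatten (map (@below J) s)).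
have belowE a (F : {ffun J -> nat} -> R) : a \in s ->
    \sum_(b <- below a) F b = \sum_(b <- t | mi_le b a) F b.
  move=> sa; rewrite -[RHS]big_filter; apply: perm_big.
  apply: uniq_perm; rewrite ?below_uniq ?filter_uniq ?undup_uniq// => b.
  rewrite mem_filter mem_below mem_undup; case: (boolP (mi_le b a)) => //= ba.
  by symmetry; apply/flattenP; exists (below a); rewrite ?map_f ?mem_below.
apply: (@le_trans _ _ (\sum_(a <- s) \sum_(b <- t | mi_le b a)
    (`|f b| * W b) * (`|g (mi_sub a b)| * W (mi_sub a b)))).
  rewrite big_seq [X in _ <= X]big_seq; apply: ler_sum => a sa.
  rewrite -belowE// serM.
  apply: le_trans (ler_wpM2r (W_ge0 _) (ler_norm_sum _ _ _)) _.
  rewrite mulr_suml big_seq [X in _ <= X]big_seq; apply: ler_sum => b.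
  rewrite mem_below => ba; rewrite normrM mulrACA ler_wpM2l ?mulr_ge0//.
  by rewrite -{1}(mi_subKr ba).
rewrite (exchange_big_dep xpredT)//=.
apply: (@le_trans _ _ (\sum_(b <- t) (`|f b| * W b) * N)); last first.
  by rewrite -mulr_suml ler_wpM2r ?(bnd_ge0 gN)// fM// undup_uniq.
apply: ler_sum => b _; rewrite -mulr_sumr ler_wpM2l ?mulr_ge0//.
rewrite -big_filter -(big_map (fun a : {ffun J -> nat} =>
  mi_sub a b) xpredT (fun c => `|g c| * W c)).
apply: gN; rewrite map_inj_in_uniq ?filter_uniq// => a c.
rewrite !mem_filter => /andP[ba _] /andP[bc _] ac.
by rewrite -(mi_subK ba) -(mi_subK bc) ac.
Qed.

End Rules.

End WeightedNorm.

(** Injectivity of [phi] where [c] does not vanish ensures that each coefficient of [f] is counted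
    at most once, so that [K] bounds the operator norm. *)
Lemma bnd_reindex (J J' : finType) (R : realFieldType)
  (W : {ffun J -> nat} -> R) (W' : {ffun J' -> nat} -> R)
  (c : {ffun J -> nat} -> R) (phi : {ffun J -> nat} -> {ffun J' -> nat}) f M K :
  0 <= K -> (forall a, c a != 0 -> `|c a| * W a <= K * W' (phi a)) ->
  (forall a b, c a != 0 -> c b != 0 -> phi a = phi b -> a = b) ->
  bnd W' f M -> bnd W (sreindex c phi f) (K * M).
Proof.
move=> K0 cK phiI fM s us.
rewrite (bigID (fun a => c a != 0))/= [X in _ + X]big1 ?addr0; last first.
  by move=> a; rewrite negbK => /eqP ca; rewrite /sreindex ca mul0r normr0 mul0r.
rewrite -big_filter; set s' := seq.filter (fun a => c a != 0) s.
apply: (@le_trans _ _ (K * \sum_(b <- map phi s') `|f b| * W' b)); last first.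
  rewrite ler_wpM2l// fM// map_inj_in_uniq ?filter_uniq// => a b.
  by rewrite !mem_filter => /andP[ca _] /andP[cb _]; exact: phiI.
rewrite big_map mulr_sumr big_seq [X in _ <= X]big_seq; apply: ler_sum => a.
rewrite mem_filter => /andP[ca _]; rewrite /sreindex normrM mulrAC mulrCA mulrC.
by rewrite ler_wpM2l// cK.
Qed.

(** * A weight adapted to division and to differentiation *)

(** The left-hand side is one term of the Vandermonde sum for the right-hand side. It yields the
    submultiplicativity of [invbin]. *)
Lemma leq_bin_add i j k l :
  ('C(i + k, k) * 'C(j + l, l) <= 'C(i + j + (k + l), k + l))%N.
Proof.
rewrite addnACA -(binomial.Vandermonde (i + k) (j + l)).
have kl : (k < (k + l).+1)%N by rewrite ltnS leq_addr.
by rewrite (bigD1 (Ordinal kl))//= addKn leq_addr.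
Qed.

Section BinomialTransform.
Variable R : realFieldType.
Implicit Types (phi psi chi : nat -> R).

Definition bintr a phi : R := \sum_(j < a.+1) 'C(a, j)%:R * phi j.

Lemma bintr0 phi : bintr 0 phi = phi 0%N.
Proof. by rewrite /bintr big_ord1 bin0 mul1r. Qed.

Lemma bintrS a phi : bintr a.+1 phi = bintr a phi + bintr a (phi \o S).
Proof.
rewrite /bintr big_ord_recl bin0 /=.
under eq_bigr do rewrite /bump/= add1n binS natrD mulrDl.
rewrite big_split /= addrA; congr (_ + _).
by rewrite big_ord_recr /= bin_small// mul0r addr0 [RHS]big_ord_recl bin0.
Qed.

Lemma ler_bintr a phi psi : (forall j, phi j <= psi j) -> bintr a phi <= bintr a psi.
Proof. by move=> pp; apply: ler_sum => j _; rewrite ler_wpM2l. Qed.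

Lemma bintr_ge0 a phi : (forall j, 0 <= phi j) -> 0 <= bintr a phi.
Proof. by move=> p0; apply: sumr_ge0 => j _; rewrite mulr_ge0. Qed.

(** [bintr a phi] applies the linear map [s^j |-> phi j] to [(1 + s)^a], so submultiplicativity of
    the values passes to the transforms. The induction on [a] shifts [phi] and [chi] together. *)
Lemma bintrD_le a b phi psi chi : (forall j, 0 <= psi j) ->
  (forall i j, chi (i + j)%N <= phi i * psi j) ->
  bintr (a + b) chi <= bintr a phi * bintr b psi.
Proof.
move=> p0; elim: a phi chi => [|a IH] phi chi cpp.
  rewrite add0n bintr0 /bintr mulr_sumr; apply: ler_sum => j _.
  by rewrite mulrCA ler_wpM2l// -{1}[j : nat]add0n.
rewrite addSn !bintrS mulrDl lerD ?IH// => i j.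
by rewrite /= -addSn.
Qed.

Lemma bintr_le_addn a b phi : (forall j, 0 <= phi j) ->
  bintr a phi <= bintr (b + a) phi.
Proof.
move=> p0; elim: b => [//|b IH]; rewrite addSn bintrS (le_trans IH)// lerDl.
by apply: bintr_ge0 => j /=.
Qed.

Lemma bintr_cst1 a : bintr a (fun=> 1) = 2 ^+ a.
Proof. by elim: a => [|a IH]; rewrite ?bintr0// bintrS IH exprS mulr_natl mulr2n. Qed.

Definition invbin k j : R := ('C(j + k, k)%:R)^-1.

Lemma bin_addn_gt0 k j : (0 : R) < 'C(j + k, k)%:R.
Proof. by rewrite ltr0n bin_gt0 leq_addl. Qed.

Lemma invbin_ge0 k j : 0 <= invbin k j.
Proof. by rewrite invr_ge0 ltW// bin_addn_gt0. Qed.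

Lemma invbin_le1 k j : invbin k j <= 1.
Proof. by rewrite invf_le1 ?bin_addn_gt0// ler1n bin_gt0 leq_addl. Qed.

Lemma invbinS_le k j : invbin k.+1 j <= invbin k j.
Proof.
rewrite lef_pV2 ?posrE ?bin_addn_gt0// ler_nat addnS binS leq_addl//.
Qed.

Lemma invbinD k l i j : invbin (k + l) (i + j) <= invbin k i * invbin l j.
Proof.
rewrite -invfM lef_pV2 ?posrE ?mulr_gt0 ?bin_addn_gt0// -natrM ler_nat.
exact: leq_bin_add.
Qed.

(** [(j+1)/(k+1)] is exactly the ratio of the weights of [x^(j+1) t^k] and [x^j t^(k+1)]. Hence a
    derivative in one variable composed with an integration in the other is bounded. *)
Lemma invbin_shift k j : invbin k.+1 j * j.+1%:R = k.+1%:R * invbin k j.+1.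
Proof.
have := mul_bin_left (j.+1 + k) k; rewrite addnK addSnnS => /(congr1 (fun n =>
  n%:R : R)).
rewrite !natrM => e; rewrite /invbin.
have c1 := bin_addn_gt0 k.+1 j; have c2 := bin_addn_gt0 k j.+1.
rewrite addSnnS in c2 *.
by apply/eqP; rewrite mulrC eqr_div ?(lt0r_neq0 c1) ?(lt0r_neq0 c2)// -e mulrC.
Qed.

(* Weight of x^a t^k.  Writing x = (x' + x'') / 2, the term x' keeps multiplication
   by x bounded below, so that division by a power of x is bounded, while the factor
   invbin k j for x''^j t^k makes d/dx o (integration in t) bounded. *)
Definition vcoef a k : R := 2 ^- a * bintr a (invbin k).

Lemma vcoef_ge0 a k : 0 <= vcoef a k.
Proof. by rewrite mulr_ge0// ?invr_ge0 ?exprn_ge0//; apply: bintr_ge0 => j;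
  exact: invbin_ge0. Qed.

Lemma vcoef_le1 a k : vcoef a k <= 1.
Proof.
rewrite /vcoef mulrC ler_pdivrMr ?exprn_gt0// mul1r -bintr_cst1.
by apply: ler_bintr => j; exact: invbin_le1.
Qed.

Lemma vcoef_ge a k : 2 ^- a <= vcoef a k.
Proof.
rewrite /vcoef ler_peMr ?invr_ge0 ?exprn_ge0//.
apply: le_trans (_ : bintr 0 (invbin k) <= _).
  by rewrite bintr0 /invbin add0n binn invr1.
have := @bintr_le_addn 0 a (invbin k); rewrite addn0; apply => j; exact: invbin_ge0.
Qed.

Lemma vcoefD a b k l : vcoef (a + b) (k + l) <= vcoef a k * vcoef b l.
Proof.
rewrite /vcoef mulrACA exprD invfM ler_wpM2l// ?mulr_ge0// ?invr_ge0 ?exprn_ge0//.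
apply: bintrD_le => [j|i j]; [exact: invbin_ge0|exact: invbinD].
Qed.

(** The gain over [invbin], for which the corresponding ratio [C(j+b+k,k)/C(j+k,k)] is unbounded in
    [k] as soon as [b > 0]. Enlarging [a] only enlarges [bintr], and the normalisation costs
    [2^b]. *)
Lemma vcoef_shift a b k : vcoef a k <= 2 ^+ b * vcoef (b + a) k.
Proof.
rewrite /vcoef exprD invfM !mulrA mulfV ?expf_neq0// mul1r ler_wpM2l//
  ?invr_ge0 ?exprn_ge0//.
by apply: bintr_le_addn => j; exact: invbin_ge0.
Qed.

Lemma vcoefS_le a k : vcoef a k.+1 <= vcoef a k.
Proof.
rewrite ler_wpM2l// ?invr_ge0 ?exprn_ge0//.
by apply: ler_bintr => j; exact: invbinS_le.
Qed.

(** [invbin_shift] term by term, with [(a+1) C(a,j) = (j+1) C(a+1,j+1)]. The term [j = 0] on the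
    right is dropped, and the 2 compensates the two normalisations [2^-a] and [2^-(a+1)]. *)
Lemma vcoef_deriv a k : a.+1%:R * vcoef a k.+1 <= 2 * (k.+1%:R * vcoef a.+1 k).
Proof.
have -> : 2 * (k.+1%:R * vcoef a.+1 k) = 2 ^- a * (k.+1%:R * bintr a.+1 (invbin k)).
  by rewrite /vcoef exprS invfM [k.+1%:R * _]mulrCA !mulrA divff// mul1r.
rewrite /vcoef mulrCA ler_wpM2l// ?invr_ge0 ?exprn_ge0//.
rewrite [X in _ <= _ * X]/bintr big_ord_recl mulrDr.
apply: (@le_trans _ _ (k.+1%:R * \sum_(i < a.+1) 'C(a.+1,
  bump 0 i)%:R * invbin k (bump 0 i))).
  rewrite /bintr !mulr_sumr; apply: ler_sum => j _.
  rewrite /bump /= add1n [X in _ <= X]mulrCA -invbin_shift mulrA.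
  have -> : a.+1%:R * 'C(a, j)%:R = j.+1%:R * 'C(a.+1, j.+1)%:R :> R.
    by rewrite -!natrM (mul_bin_diag a.+1).
  by rewrite le_eqVlt; apply/orP; left; apply/eqP; ring.
by rewrite lerDr mulr_ge0// mulr_ge0// invbin_ge0.
Qed.

End BinomialTransform.

(** * Operators on series in x and t and their norms *)

Section Weights.
Variables (I : finType) (R : realFieldType).
Local Notation J := (option I).
Local Notation S := (series J R).
Local Notation D i := (sderiv (Some i)).
Local Notation Dt := (sderiv (None : J)).
Local Notation xdeg := (weight (@xweight I)).
Local Notation et := (unit_mi (None : J)).
Local Notation ex i := (unit_mi (Some i : J)).

Definition pweight (K : finType) (rho : R) (a : {ffun K -> nat}) : R :=
  rho ^+ weight (fun=> 1%N) a.

Definition mi_lift (a : {ffun I -> nat}) : {ffun J -> nat} :=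
  [ffun j => if j is Some i then a i else 0%N].
Definition mi_proj (a : {ffun J -> nat}) : {ffun I -> nat} := [ffun i => a (Some i)].

Definition slift : series I R -> S := sreindex (fun a => (a None == 0%N)%:R) mi_proj.
Definition sres : S -> series I R := sreindex (fun=> 1) mi_lift.
(* The coefficients without t vanish, since 0^-1 = 0. *)
Definition sint : S -> S := sreindex (fun a => (a None)%:R^-1) (fun a => mi_sub a et).

Lemma xdegE (a : {ffun J -> nat}) : xdeg a = (\sum_i a (Some i))%N.
Proof.
rewrite /weight big_option /= mul0n.
by rewrite -[LHS]/(0 + \sum_i 1 * a (Some i))%N; apply: eq_bigr => i _; rewrite mul1n.
Qed.

Lemma xdeg_et : xdeg et = 0%N. Proof. by rewrite weight_unit. Qed.
Lemma xdeg_ex i : xdeg (ex i) = 1%N. Proof. by rewrite weight_unit. Qed.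

Lemma xdeg_lift a : xdeg (mi_lift a) = weight (fun=> 1%N) a.
Proof. by rewrite xdegE /weight; apply: eq_bigr => i _; rewrite ffunE mul1n. Qed.

Lemma mi_projK (a : {ffun J -> nat}) : a None = 0%N -> mi_lift (mi_proj a) = a.
Proof. by move=> a0; apply/ffunP => -[i|]; rewrite !ffunE. Qed.

Lemma mi_liftK a : mi_proj (mi_lift a) = a.
Proof. by apply/ffunP => i; rewrite !ffunE. Qed.

Lemma mi_lift_None a : mi_lift a None = 0%N. Proof. by rewrite ffunE. Qed.

Lemma sresE F a : sres F a = F (mi_lift a).
Proof. by rewrite /sres /sreindex mul1r. Qed.

Lemma sresD F G : sres (F + G) = sres F + sres G.
Proof. exact: sreindexD. Qed.

Lemma sresB F G : sres (F - G) = sres F - sres G.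
Proof. exact: sreindexB. Qed.

Lemma sresM F G : sres (F * G) = sres F * sres G.
Proof.
apply/funext => a; rewrite sresE !serM.
have lift_sub b c : mi_lift (mi_sub b c) = mi_sub (mi_lift b) (mi_lift c).
  by apply/ffunP => -[i|]; rewrite !ffunE.
transitivity (\sum_(b <- map mi_lift (below a)) F b * G (mi_sub (mi_lift a) b)).
  apply: perm_big; apply: uniq_perm; rewrite ?below_uniq//.
    by rewrite map_inj_uniq ?below_uniq//; exact: can_inj mi_liftK.
  move=> b; rewrite mem_below; apply/idP/mapP => [/mi_leP ba|[c]].
    exists (mi_proj b); last first.
      by rewrite mi_projK//; have := ba None; rewrite mi_lift_None leqn0 => /eqP.
    by rewrite mem_below; apply/mi_leP => i; have := ba (Some i); rewrite !ffunE.
  rewrite mem_below => /mi_leP ca ->; apply/mi_leP => -[i|]; rewrite !ffunE//.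
by rewrite big_map; apply: eq_bigr => b _; rewrite !sresE lift_sub.
Qed.

Lemma sres_deriv F i : sres (D i F) = sderiv i (sres F).
Proof.
apply/funext => a; rewrite sresE /sderiv sresE ffunE; congr (F _ *+ _).
by apply/ffunP => -[j|]; rewrite !ffunE.
Qed.

Lemma sres_lift f : sres (slift f) = f.
Proof.
apply/funext => a; rewrite sresE /slift /sreindex mi_lift_None eqxx mul1r.
by rewrite mi_liftK.
Qed.

Lemma sres_int F : sres (sint F) = 0.
Proof.
by apply/funext => a; rewrite sresE /sint /sreindex mi_lift_None invr0 mul0r.
Qed.

Lemma sres_smono i k : sres (smono R (ex i *+ k)) = smono R (unit_mi i *+ k).
Proof.
apply/funext => a; rewrite sresE /smono; congr (_%:R); congr (nat_of_bool _).
apply/eqP/eqP => [/(congr1 mi_proj)|->]; rewrite ?mi_liftK.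
  by move=> ->; apply/ffunP => j; rewrite ffunE !miMn !unit_miE.
by apply/ffunP => -[j|]; rewrite ffunE !miMn !unit_miE.
Qed.

Lemma sderiv_sint F : Dt (sint F) = F.
Proof.
apply/funext => a; rewrite /sderiv /sint /sreindex mi_addK miD unit_miE eqxx addn1.
by rewrite -[LHS]mulr_natl mulVKf// pnatr_eq0.
Qed.

Lemma sintB F G : sint (F - G) = sint F - sint G. Proof. exact: sreindexB. Qed.

Lemma ord_sint w k F : ord w k F -> ord w (k + w None) (sint F).
Proof.
move=> Fk a ak; rewrite /sint /sreindex.
have [a0|a0] := posnP (a None); first by rewrite a0 invr0 mul0r.
rewrite Fk ?mulr0// weight_sub ?mi_le_unit// weight_unit.
have := @weight_le _ w a et; rewrite mi_le_unit weight_unit => /(_ a0).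
by move: ak; lia.
Qed.

Definition uwt (rho tau : R) (a : {ffun J -> nat}) : R :=
  rho ^+ xdeg a * tau ^+ a None * vcoef R (xdeg a) (a None).

(** The norm for radial integration. No division by [x^m] occurs there, so the plain [invbin] weight
    is enough. *)
Definition fwt (rho tau : R) (a : {ffun J -> nat}) : R :=
  rho ^+ xdeg a * tau ^+ a None * invbin R (a None) (xdeg a).

Section Bounds.
Variables (rho tau : R).
Hypotheses (rho0 : 0 < rho) (tau0 : 0 < tau).
Local Notation W := (uwt rho tau).
Local Notation W' := (fwt rho tau).

Let rt_ge0 x k : 0 <= rho ^+ x * tau ^+ k.
Proof. by rewrite mulr_ge0// exprn_ge0// ltW. Qed.

Lemma uwt_ge0 a : 0 <= W a.
Proof. by rewrite mulr_ge0// vcoef_ge0. Qed.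

Lemma fwt_ge0 a : 0 <= W' a.
Proof. by rewrite mulr_ge0// invbin_ge0. Qed.

Lemma uwtD a b : W (a + b) <= W a * W b.
Proof.
rewrite /uwt weightD miD !exprD [X in X * vcoef _ _ _ <= _]mulrACA [leRHS]mulrACA.
rewrite ler_wpM2l ?vcoefD//.
by rewrite mulr_ge0.
Qed.

Lemma fwtD a b : W' (a + b) <= W' a * W' b.
Proof.
rewrite /fwt weightD miD !exprD [X in X * invbin _ _ _ <= _]mulrACA [leRHS]mulrACA.
rewrite ler_wpM2l ?invbinD//.
by rewrite mulr_ge0.
Qed.

Lemma uwt_le a : W a <= rho ^+ xdeg a * tau ^+ a None.
Proof. by rewrite ler_piMr// vcoef_le1. Qed.

Lemma bnd_squot m i f M : bnd W f M -> bnd W (squot m (Some i) f) ((2 / rho) ^+ m * M).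
Proof.
apply: bnd_reindex => [|a _|a b _ _ /mi_addIr//].
  by rewrite exprn_ge0// divr_ge0// ltW.
rewrite ger0_norm ?invr_ge0//; apply: (@le_trans _ _ (W a)).
  by rewrite ler_piMl ?uwt_ge0// invf_le1 ?ltr0n// ler1n.
rewrite /uwt weightD weightMn xdeg_ex mul1n miD miMn unit_miE mul0n addn0.
rewrite expr_div_n exprD; set t := tau ^+ _; set v := vcoef _ (_ + _) _.
have -> : 2 ^+ m / rho ^+ m * (rho ^+ xdeg a * rho ^+ m * t * v) =
    rho ^+ xdeg a * t * (2 ^+ m * v).
  by field; rewrite expf_neq0// gt_eqF.
apply: ler_wpM2l; first exact: rt_ge0.
by rewrite /v addnC vcoef_shift.
Qed.

Lemma bnd_srem m i f M : bnd W f M -> bnd W (srem m (Some i) f) M.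
Proof.
rewrite -{2}[M]mul1r; apply: bnd_reindex => // a _.
by rewrite mul1r ger0_norm// ler_piMl ?uwt_ge0// lern1 leq_b1.
Qed.

Let et_inj (a b : {ffun J -> nat}) : (a None)%:R^-1 != 0 :> R ->
  (b None)%:R^-1 != 0 :> R -> mi_sub a et = mi_sub b et -> a = b.
Proof.
rewrite !invr_eq0 !pnatr_eq0 -!lt0n -!(mi_le_unit None) => ea eb ab.
by rewrite -(mi_subK ea) -(mi_subK eb) ab.
Qed.

Lemma bnd_sint f M : bnd W f M -> bnd W (sint f) (tau * M).
Proof.
apply: bnd_reindex => [|a a0|]; [exact: ltW| |exact: et_inj].
move: a0; rewrite invr_eq0 pnatr_eq0 -lt0n => a0.
rewrite ger0_norm ?invr_ge0// /uwt weight_sub ?mi_le_unit// xdeg_et subn0.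
rewrite [mi_sub _ _ _]ffunE unit_miE eqxx; case: (a None) a0 => // k _.
rewrite subn1 /= exprS; set v := vcoef R _ k; set v' := vcoef R _ k.+1.
have -> : tau * (rho ^+ xdeg a * tau ^+ k * v) = rho ^+ xdeg a * (tau * tau ^+ k) * v.
  by ring.
rewrite mulrCA ler_wpM2l ?mulr_ge0 ?exprn_ge0 ?(ltW rho0) ?(ltW tau0)//.
apply: (@le_trans _ _ v'); last exact: vcoefS_le.
rewrite ler_piMl ?vcoef_ge0//.
by rewrite invf_le1 ?ltr0n// ler1n.
Qed.

(** The derivative multiplies by at most the degree in [x] plus one, and integration divides by the
    exponent of [t]; [vcoef_deriv] absorbs this quotient. The factor [tau] will make the term
    small. *)
Lemma bnd_deriv_sint i f M : bnd W f M -> bnd W (D i (sint f)) (2 * tau / rho * M).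
Proof.
move=> fM.
have -> : D i (sint f) = sreindex (fun a => (a (Some i)).+1%:R / (a None)%:R)
    (fun a => mi_sub a et + ex i) f.
  apply/funext => a; rewrite /sderiv /sint /sreindex miD unit_miE addn0.
  rewrite -[LHS]mulr_natl mulrA; have [->|a0] := posnP (a None).
    by rewrite invr0 !mulr0 !mul0r.
  by congr (_ * f _); apply/ffunP => j; rewrite !ffunE /=; case: j => [j|] /=; lia.
apply: bnd_reindex fM => [|a|a b].
- by rewrite divr_ge0 ?mulr_ge0// ltW.
- rewrite mulf_eq0 negb_or => /andP[_]; rewrite invr_eq0 pnatr_eq0 -lt0n => a0.
  rewrite ger0_norm ?divr_ge0// /uwt weightD weight_sub ?mi_le_unit//
    xdeg_et subn0 xdeg_ex.
  rewrite miD [mi_sub _ _ _]ffunE !unit_miE eqxx addn0.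
  have ax : (a (Some i) <= xdeg a)%N by rewrite leq_weight.
  case: (a None) a0 => // k _; rewrite subn1 /= addn1.
  apply: (@le_trans _ _ ((xdeg a).+1%:R / k.+1%:R *
      (rho ^+ xdeg a * tau ^+ k.+1 * vcoef R (xdeg a) k.+1))).
    apply: ler_wpM2r; first by apply: mulr_ge0; [exact: rt_ge0|exact: vcoef_ge0].
    by rewrite ler_wpM2r ?invr_ge0// ler_nat ltnS.
  have := @vcoef_deriv R (xdeg a) k.
  set v := vcoef _ _ _; set v' := vcoef _ _ _ => vv.
  have k0 : 0 < k.+1%:R :> R by rewrite ltr0n.
  have -> : 2 * tau / rho * (rho ^+ (xdeg a).+1 * tau ^+ k * v') =
     rho ^+ xdeg a * tau ^+ k.+1 / k.+1%:R * (2 * (k.+1%:R * v')).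
    by rewrite !exprS; field; rewrite gt_eqF//= gt_eqF.
  have -> : (xdeg a).+1%:R / k.+1%:R * (rho ^+ xdeg a * tau ^+ k.+1 * v) =
     rho ^+ xdeg a * tau ^+ k.+1 / k.+1%:R * ((xdeg a).+1%:R * v).
    by ring.
  by rewrite ler_wpM2l// mulr_ge0// invr_ge0 ltW.
- rewrite !mulf_eq0 !negb_or => /andP[_ a0] /andP[_ b0] /mi_addIr.
  exact: et_inj.
Qed.

Lemma bnd_slift rho1 f M : rho <= rho1 -> bnd (pweight rho1) f M -> bnd W (slift f) M.
Proof.
move=> rr; rewrite -{2}[M]mul1r; apply: bnd_reindex => // [a|a b].
  rewrite pnatr_eq0 eqb0 negbK => /eqP a0; rewrite a0 normr1 !mul1r;
    apply: le_trans (uwt_le a) _.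
  rewrite a0 mulr1 /pweight -xdeg_lift mi_projK//.
  by rewrite lerXn2r// ?nnegrE ltW// (lt_le_trans rho0).
rewrite !pnatr_eq0 !eqb0 !negbK => /eqP a0 /eqP b0.
by move=> /(congr1 mi_lift); rewrite !mi_projK.
Qed.

(** No integration in [t] compensates here. As [a i + 1] is at most 2 to the degree, halving the
    radius pays for the derivative; this is affordable because it is applied to the given [theta]
    only and not iterated. *)
Lemma bnd_deriv_slift rho1 f M i : 2 * rho <= rho1 -> bnd (pweight rho1) f M ->
  bnd W (D i (slift f)) (rho1^-1 * M).
Proof.
move=> rr fM.
have r10 : 0 < rho1 by apply: lt_le_trans rr; rewrite mulr_gt0.
have -> : D i (slift f) = sreindex (fun a => (a (Some i)).+1%:R * (a None == 0%N)%:R)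
    (fun a => mi_proj a + unit_mi i) f.
  apply/funext => a; rewrite /sderiv /slift /sreindex miD unit_miE addn0.
  rewrite -[LHS]mulr_natl mulrA; congr (_ * f _).
  by apply/ffunP => j; rewrite !ffunE.
apply: bnd_reindex fM => [|a|a b]; first by rewrite invr_ge0 ltW.
  rewrite mulf_eq0 negb_or => /andP[_].
  rewrite pnatr_eq0 eqb0 negbK => /eqP a0; rewrite a0 eqxx mulr1 ger0_norm//.
  apply: le_trans (ler_wpM2l _ (uwt_le a)) _ => //; rewrite a0 mulr1.
  rewrite /pweight weightD weight_unit -xdeg_lift mi_projK//
    addn1 exprS mulKf ?gt_eqF//.
  have ax : (a (Some i) <= xdeg a)%N by rewrite leq_weight.
  apply: (@le_trans _ _ ((2 * rho) ^+ xdeg a)); last first.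
    by rewrite lerXn2r// ?nnegrE ?mulr_ge0// ltW// ltW.
  rewrite exprMn ler_wpM2r ?exprn_ge0 ?(ltW rho0) ?(ltW tau0)// -natrX ler_nat.
  by apply: leq_ltn_trans ax _; rewrite ltn_expl.
rewrite !mulf_eq0 !negb_or !pnatr_eq0 !eqb0 !negbK => /andP[_ /eqP a0] /andP[_ /eqP b0].
by move=> /mi_addIr/(congr1 mi_lift); rewrite !mi_projK.
Qed.

(** Passage from the norm of the unfolding to that of radial integration: [vcoef] is at least 2 to
    minus the degree in [x] and [invbin] is at most 1, so half the radius suffices. *)
Lemma bnd_uwt_fwt rho' f M : 0 <= rho' -> 2 * rho' <= rho -> bnd W f M ->
  bnd (fwt rho' tau) f M.
Proof.
move=> r'0 rr; apply: bnd_leW => a.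
apply: (@le_trans _ _ (rho' ^+ xdeg a * tau ^+ a None)).
  by rewrite /fwt ler_piMr ?invbin_le1// mulr_ge0// exprn_ge0// ltW.
apply: (@le_trans _ _ (rho ^+ xdeg a * tau ^+ a None * 2 ^- xdeg a)); last first.
  by rewrite /uwt ler_wpM2l// vcoef_ge.
rewrite mulrAC ler_wpM2r ?exprn_ge0 ?(ltW tau0)//.
rewrite -expr_div_n lerXn2r ?nnegrE// ?divr_ge0 ?(ltW rho0) ?(ltW tau0)//.
by rewrite ler_pdivlMr// mulrC.
Qed.

(** The mirror image of [bnd_deriv_sint], with the derivative in [t] and the integration in [x]; by
    [invbin_shift] the comparison of weights is even an equality. *)
Lemma bnd_deriv_rinv i f M :
  bnd W' f M -> bnd W' (Dt (rinv (smono R (ex i) * f))) (rho / tau * M).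
Proof.
move=> fM.
have -> : Dt (rinv (smono R (ex i) * f)) = sreindex
    (fun a => if (0 < a (Some i))%N then (a None).+1%:R / (xdeg a)%:R else 0)
    (fun a => mi_sub a (ex i) + et) f.
  apply/funext => a; rewrite /sderiv /rinv /sreindex smonoM mi_le_unit miD unit_miE addn0.
  case: ifP => ai; last by rewrite mulr0 mul0rn mul0r.
  rewrite weightD xdeg_et addn0 -[LHS]mulr_natl mulrA; congr (_ * f _).
  by apply/ffunP => j; rewrite !ffunE /=; case: eqP => [->|]; case: j => [j|] /=; lia.
apply: bnd_reindex fM => [|a|a b].
- by rewrite divr_ge0// ltW.
- case: ifP => [ai _|]; last by rewrite eqxx.
  have ax : (0 < xdeg a)%N by rewrite (leq_trans ai)// leq_weight.
  rewrite ger0_norm ?divr_ge0// /fwt weightD weight_sub ?mi_le_unit//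
    xdeg_et xdeg_ex addn0.
  rewrite miD [mi_sub _ _ _]ffunE !unit_miE eqxx /= subn0 addn1.
  case: (xdeg a) ax => // x _; rewrite subn1 /=; set k := a None.
  have := @invbin_shift R k x; set v := invbin _ _ _; set v' := invbin _ _ _ => vv.
  have x0 : x.+1%:R != 0 :> R by rewrite pnatr_eq0.
  have -> : k.+1%:R / x.+1%:R * (rho ^+ x.+1 * tau ^+ k * v') =
     rho ^+ x.+1 * tau ^+ k / x.+1%:R * (k.+1%:R * v') by ring.
  rewrite -vv le_eqVlt; apply/orP; left; apply/eqP.
  by rewrite !exprS; field; rewrite (gt_eqF tau0) nat1r x0.
- case: ifP => [ai _|]; last by rewrite eqxx.
  case: ifP => [bi _|]; last by rewrite eqxx.
  move=> /mi_addIr ab; rewrite -(@mi_subK _ a (ex i)) ?mi_le_unit//.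
  by rewrite ab mi_subK// mi_le_unit.
Qed.

Lemma bnd_rinv f M : bnd W' f M -> bnd W' (rinv f) M.
Proof.
rewrite -{2}[M]mul1r; apply: bnd_reindex => // a.
rewrite invr_eq0 pnatr_eq0 -lt0n => a0.
by rewrite mul1r ger0_norm ?invr_ge0// ler_piMl ?fwt_ge0// invf_le1 ?ltr0n// ler1n.
Qed.

Lemma bnd_sres f M : bnd W' f M -> bnd (pweight rho) (sres f) M.
Proof.
rewrite -{2}[M]mul1r; apply: bnd_reindex => // [a _|a b _ _ /(can_inj mi_liftK)//].
rewrite normr1 !mul1r /fwt xdeg_lift mi_lift_None mulr1 /invbin bin0 invr1 mulr1.
by [].
Qed.

End Bounds.
End Weights.

(** * Existence of a convergent first integral *)

(** The inverse of a sum, taken as a radius, meets two smallness conditions at once. *)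
Lemma inv_add_le1 (R : realFieldType) (x y : R) : 0 <= x -> 0 <= y -> 0 < x + y ->
  [/\ 0 < (x + y)^-1, (x + y)^-1 * x <= 1 & (x + y)^-1 * y <= 1].
Proof.
move=> x0 y0 xy; rewrite invr_gt0 xy; split=> //.
  by rewrite mulrC ler_pdivrMr// mul1r lerDl.
by rewrite mulrC ler_pdivrMr// mul1r lerDr.
Qed.

Section Existence.
Variables (I : finType) (R : realFieldType) (m : nat) (pr : pred I).
Variables i1 i2 i3 : I.
Hypotheses (pr1 : pr i1) (pr2 : pr i2) (pr3 : pr i3).
Hypotheses (n12 : i1 != i2) (n13 : i1 != i3) (n23 : i2 != i3).
Variables (theta : I -> series I R) (rho0 Mt : R).
Hypothesis rho0_gt0 : 0 < rho0.
Hypothesis theta_bnd : forall i, bnd (pweight rho0) (theta i) Mt.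

Local Notation J := (option I).
Local Notation S := (series J R).
Local Notation D i := (sderiv (Some i)).
Local Notation Dt := (sderiv (None : J)).
Local Notation ex i := (unit_mi (Some i : J)).
Local Notation P := (spham R m pr).

Definition pham_series : series I R :=
  \sum_(i | pr i) smono R (unit_mi i *+ m.+1).
Definition omega_series i := sderiv i pham_series + pham_series * theta i.

Hypothesis integrable : forall i j k, wedge12s omega_series
  (fun i j => sderiv i (omega_series j) - sderiv j (omega_series i)) i j k = 0.

Let C0 i : S := P * slift (theta i).
(** The unknown is [X = d/dt C] rather than [C]: then the unknown is differentiated in [x] only
    after an integration in [t]. *)
Let Cof (X : I -> S) i : S := C0 i + sint (X i).
Let Phi (X : I -> S) : I -> S := kdiv m Some i1 i2 (unf_rhs (Cof X) X).

Lemma sres_spham : sres P = pham_series.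
Proof.
rewrite /spham /pham_series; have s0 : sres (0 : S) = 0 by exact: sreindex0.
by elim/big_ind2 : _ => // [f f' g g' <- <-|i _]; [exact: sresD|exact: sres_smono].
Qed.

Let Cof_ord X i : ord (@uweight I m) m.+1 (Cof X i).
Proof.
apply: ordD; first by rewrite -[m.+1]addn0; apply: ordM => //;
  apply: ord_spham => j; rewrite mul1n.
by apply: (@ord_le _ _ _ _ (0 + m.+2)) => //; exact: ord_sint.
Qed.

Let w := @uweight I m.

Let ord_squot k i (f : S) : ord w (k + m) f -> ord w k (squot m (Some i) f).
Proof.
apply: ord_sreindex => a _ ak; rewrite weightD weightMn weight_unit mul1n.
by rewrite ltn_add2r.
Qed.

Let ord_srem k i (f : S) : ord w k f -> ord w k (srem m (Some i) f).
Proof. exact: ord_sreindex. Qed.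

Let kdivB (G H : I -> I -> S) j :
  kdiv m Some i1 i2 G j - kdiv m Some i1 i2 H j =
  kdiv m Some i1 i2 (fun i j => G i j - H i j) j.
Proof. by rewrite /kdiv; case: eqP => _; rewrite /squot /srem !sreindexB. Qed.

(** Division loses [m], so the right-hand sides must agree to order [N + m + 1]: integration in [t]
    followed by [d/dx] gains [(m+2) - 1], and multiplication by [C] gains [m+1]. *)
Let Phi_contr N X Y : (forall i, ord w N (X i - Y i)) ->
  forall i, ord w N.+1 (Phi X i - Phi Y i).
Proof.
move=> XY j; rewrite /Phi kdivB.
suff H k l : ord w (N.+1 + m) (unf_rhs (Cof X) X k l - unf_rhs (Cof Y) Y k l).
  rewrite /kdiv; case: eqP => _; last exact: ord_squot.
  by apply: ord_srem; exact: ord_squot.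
have dC k' l' : ord w (N.+1 + m) (D k' (Cof X l') - D k' (Cof Y l')).
  rewrite -sderivB /Cof.
  have -> : C0 l' + sint (X l') - (C0 l' + sint (Y l')) = sint (X l' - Y l').
    by rewrite sintB; ring.
  apply: (@ord_le _ _ _ _ (N + m.+2 - 1)); first by lia.
  exact/(@ord_sderiv _ _ w _ (Some k'))/ord_sint.
have CX k' l' : ord w (N.+1 + m) (Cof X k' * X l' - Cof Y k' * Y l').
  have -> : Cof X k' * X l' - Cof Y k' * Y l' =
     sint (X k' - Y k') * X l' + Cof Y k' * (X l' - Y l').
    by rewrite sintB /Cof; ring.
  apply: ordD.
    apply: (@ord_le _ _ _ _ (N + m.+2 + 0)); first by lia.
    by apply: ordM => //; exact: ord_sint.
  apply: (@ord_le _ _ _ _ (m.+1 + N)); first by lia.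
  by apply: ordM.
rewrite /unf_rhs.
have -> : D k (Cof X l) - D l (Cof X k) - (Cof X k * X l - Cof X l * X k) -
    (D k (Cof Y l) - D l (Cof Y k) - (Cof Y k * Y l - Cof Y l * Y k)) =
  (D k (Cof X l) - D k (Cof Y l)) - (D l (Cof X k) - D l (Cof Y k)) -
  ((Cof X k * X l - Cof Y k * Y l) - (Cof X l * X k - Cof Y l * Y k)) by ring.
by apply: ordB; apply: ordB.
Qed.

Section Estimate.
Variables rho tau : R.
Hypotheses (rho_gt0 : 0 < rho) (tau_gt0 : 0 < tau) (rho_le1 : rho <= 1)
  (rho_le : 2 * rho <= rho0).
Local Notation W := (@uwt I R rho tau).
Local Notation n := (#|I|%:R : R).

Let Mt_ge0 : 0 <= Mt. Proof. exact: bnd_ge0 (theta_bnd i1). Qed.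
Let W0 := uwt_ge0 (I := I) rho_gt0 tau_gt0.
Let WD := uwtD (I := I) rho_gt0 tau_gt0.

Let bnd_xn i k : bnd W (smono R (ex i *+ k)) (rho ^+ k).
Proof.
apply: bnd_le (bnd_smono W0 _); apply: le_trans (uwt_le rho_gt0 tau_gt0 _) _.
by rewrite weightMn weight_unit mul1n miMn unit_miE mul0n expr0 mulr1.
Qed.

Let bnd_P : bnd W P (n * rho ^+ m.+1).
Proof.
apply: bnd_le (bnd_sum W0 _ (M := fun=> rho ^+ m.+1) _); last by move=> i _;
  exact: bnd_xn.
rewrite sumr_const -[leLHS]mulr_natl ler_wpM2r ?exprn_ge0 ?(ltW rho_gt0)//.
by rewrite ler_nat max_card.
Qed.

Let bnd_nat_mul k (f : S) M : bnd W f M -> bnd W (f *+ k) (k%:R * M).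
Proof.
move=> fM; elim: k => [|k IH]; first by rewrite mulr0n mul0r; exact: bnd0.
by rewrite mulrS -nat1r mulrDl mul1r; exact: bndD.
Qed.

Let bnd_dP i : bnd W (D i P) m.+1%:R.
Proof.
rewrite sderiv_spham; case: ifP => _; last by apply: bnd_le (bnd0 _).
rewrite -[m.+1%:R]mulr1; apply: bnd_nat_mul; apply: bnd_le (bnd_xn _ _).
by rewrite exprn_ile1// ltW.
Qed.

Let bnd_lift i : bnd W (slift (theta i)) Mt.
Proof.
apply: bnd_slift (theta_bnd i) => //; apply: le_trans rho_le.
by rewrite mulr_natl mulr2n lerDl ltW.
Qed.

(** Bounds the derivatives of [P theta]: [m+1] comes from [dP], [n] from [P] with [rho <= 1], and
    [rho0^-1 * Mt] from the derivatives of [theta]. *)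
Let N1 := m.+1%:R * Mt + n * (rho0^-1 * Mt).

Let bnd_dC0 i j : bnd W (D i (C0 j)) N1.
Proof.
rewrite sderivM; apply: bndD => //; first by apply: bndM.
have dl := bnd_deriv_slift rho_gt0 tau_gt0 i rho_le (theta_bnd j).
apply: bndM => //; apply: bnd_le bnd_P.
by rewrite ler_piMr// exprn_ile1// ltW.
Qed.

Let bnd_C0 i : bnd W (C0 i) (n * rho ^+ m.+1 * Mt).
Proof. exact: bndM. Qed.

Let q := (2 / rho) ^+ m.

Let bnd_kdiv (G : I -> I -> S) M : (forall i j, bnd W (G i j) M) ->
  forall j, bnd W (kdiv m Some i1 i2 G j) (q * M).
Proof.
move=> GM j; rewrite /kdiv; case: eqP => _; last exact: bnd_squot.
by apply: bnd_srem => //; exact: bnd_squot.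
Qed.

Variable M : R.
Hypothesis M_large : 8 * q * N1 <= M.
Hypothesis rho_small : rho * (2 ^+ m.+2 * n * Mt) <= 1.
Hypothesis tau_small : tau * (4 * q * (4 / rho + 2 * M)) <= 1.

Let M_ge0 : 0 <= M.
Proof.
apply: le_trans M_large; rewrite !mulr_ge0 ?exprn_ge0 ?divr_ge0 ?(ltW rho_gt0)//.
by rewrite addr_ge0// !mulr_ge0// invr_ge0 ltW.
Qed.

Let Phi_bnd X : (forall i, bnd W (X i) M) -> forall i, bnd W (Phi X i) M.
Proof.
move=> XM j.
have Cb i : bnd W (Cof X i) (n * rho ^+ m.+1 * Mt + tau * M).
  by apply: bndD => //; exact: bnd_sint.
have dCb k l : bnd W (D k (Cof X l)) (N1 + 2 * tau / rho * M).
  by rewrite /Cof sderivD; apply: bndD => //; exact: bnd_deriv_sint.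
have CXb k l : bnd W (Cof X k * X l) ((n * rho ^+ m.+1 * Mt + tau * M) * M).
  exact: bndM.
have rhsb k l : bnd W (unf_rhs (Cof X) X k l)
    ((N1 + 2 * tau / rho * M) + (N1 + 2 * tau / rho * M) +
     ((n * rho ^+ m.+1 * Mt + tau * M) * M + (n * rho ^+ m.+1 * Mt + tau * M) * M)).
  by apply: bndB => //; apply: bndB.
apply: bnd_le (bnd_kdiv rhsb _).
(* [q] carries [rho^-m] and [P] carries [rho^(m+1)]: one factor [rho] survives the division and
   makes this term small. *)
have e1 : q * (n * rho ^+ m.+1 * Mt) * 4 = rho * (2 ^+ m.+2 * n * Mt).
  rewrite /q expr_div_n !exprS; field; rewrite expf_neq0// gt_eqF//.
move: rho_small; rewrite -e1 => rs.
(* The three summands come from [dC0], from [C0 /\ X] and from the integrals in [t]; their budgets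
   are [M/4], [M/2] and [M/4]. *)
have e2 : q * (N1 + 2 * tau / rho * M + (N1 + 2 * tau / rho * M) +
     ((n * rho ^+ m.+1 * Mt + tau * M) * M + (n * rho ^+ m.+1 * Mt + tau * M) * M)) =
  8 * q * N1 / 4 + q * (n * rho ^+ m.+1 * Mt) * 4 * (M / 2) +
  tau * (4 * q * (4 / rho + 2 * M)) * (M / 4).
  by field; rewrite gt_eqF.
rewrite e2.
have h1 : 8 * q * N1 / 4 <= M / 4 by rewrite ler_wpM2r.
have h2 : q * (n * rho ^+ m.+1 * Mt) * 4 * (M / 2) <= M / 2 by rewrite ler_piMl//
  divr_ge0.
have h3 : tau * (4 * q * (4 / rho + 2 * M)) * (M / 4) <=
  M / 4 by rewrite ler_piMl// divr_ge0.
by lra.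
Qed.

Lemma unfolding_exists : exists (X : I -> S) MA,
  (forall i, X i = kdiv m Some i1 i2 (unf_rhs (Cof X) X) i) /\
  forall i, bnd W (D i P + Cof X i) MA.
Proof.
have [X [XE Xit]] := series_fixpoint Phi_contr.
exists X, (m.+1%:R + (n * rho ^+ m.+1 * Mt + tau * M)).
split=> i; first by rewrite -[LHS]XE.
apply: bndD => //; apply: bndD => //; apply: bnd_sint => //.
apply: (@bnd_approx _ _ _ w) => N; exists (iter N Phi (fun=> 0) i); split=> //.
elim: N i {XE Xit} => [|N IH] i; first by apply: bnd_le (bnd0 _).
exact: Phi_bnd.
Qed.

End Estimate.

Lemma first_integral_series : exists rho M (f g : series I R),
  [/\ 0 < rho, bnd (pweight rho) f M, bnd (pweight rho) g M,
      forall i, sderiv i f = omega_series i * g & g 0 = 1].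
Proof.
have Mt_ge0 : 0 <= Mt by exact: bnd_ge0 (theta_bnd i1).
pose n := #|I|%:R : R; have n_ge0 : 0 <= n by exact: ler0n.
(* The order of choice matters: [rho], then [M], whose factor [q] depends on [rho], then [tau],
   whose condition involves both. The summands give [rho <= 1], [2 * rho <= rho0] and the smallness
   of the [C0] term. *)
pose rho := (1 + 2 / rho0 + 2 ^+ m.+2 * n * Mt)^-1.
have den1 : 0 <= 2 / rho0 by rewrite divr_ge0// ltW.
have den2 : 0 <= 2 ^+ m.+2 * n * Mt.
  by apply: mulr_ge0 => //; apply: mulr_ge0 => //; exact: exprn_ge0.
have den12 : 0 <= 1 + 2 / rho0 by rewrite addr_ge0.
have den12' : 0 < 1 + 2 / rho0 + 2 ^+ m.+2 * n * Mt.
  by rewrite ltr_wpDr// ltr_wpDr.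
have [rho_gt0 rho_le12 rho_small] := inv_add_le1 den12 den2 den12'.
rewrite -/rho in rho_gt0 rho_le12 rho_small.
have rho_le1 : rho <= 1.
  by apply: le_trans rho_le12; rewrite ler_peMr ?(ltW rho_gt0)// lerDl.
have rho_le : 2 * rho <= rho0.
  suff : rho * (2 / rho0) <= 1.
    by rewrite mulrA ler_pdivrMr// mul1r mulrC.
  by apply: le_trans rho_le12; rewrite ler_wpM2l ?(ltW rho_gt0)// lerDr.
pose q := (2 / rho) ^+ m.
have q_ge0 : 0 <= q by rewrite exprn_ge0// divr_ge0// ltW.
pose M := 8 * q * (m.+1%:R * Mt + n * (rho0^-1 * Mt)).
have M_ge0 : 0 <= M.
  apply: mulr_ge0; first exact: mulr_ge0.
  apply: addr_ge0; apply: mulr_ge0 => //.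
  by apply: mulr_ge0 => //; rewrite invr_ge0 ltW.
have den3 : 0 <= 4 * q * (4 / rho + 2 * M).
  apply: mulr_ge0; first exact: mulr_ge0.
  by apply: addr_ge0; [rewrite divr_ge0 ?(ltW rho_gt0)|exact: mulr_ge0].
pose tau := (1 + 4 * q * (4 / rho + 2 * M))^-1.
have den3' : 0 < 1 + 4 * q * (4 / rho + 2 * M) by rewrite ltr_wpDr.
have [tau_gt0 _ tau_small] := inv_add_le1 ler01 den3 den3'.
rewrite -/tau in tau_gt0 tau_small.
have [X [MA [XE MAb]]] := unfolding_exists rho_gt0 tau_gt0 rho_le1 rho_le
  (lexx M) rho_small tau_small.
pose C i := C0 i + sint (X i); pose A i := D i P + C i.
have DtC i : Dt (C i) = X i.
  rewrite /C sderivD sderiv_sint /C0 sderivM sderivt_spham mul0r add0r.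
  suff -> : Dt (slift (theta i)) = 0 by rewrite mulr0 add0r.
  apply/funext => a; rewrite /sderiv /slift /sreindex miD unit_miE eqxx addn1.
  by rewrite mul0r mul0rn.
have sresA i : sres (A i) = omega_series i.
  rewrite /A /C !sresD sres_int addr0 sres_deriv sres_spham sresM sres_spham.
  by rewrite sres_lift.
(* The coefficients without [t] are those of the restriction to [t = 0], where [A] becomes
   [omega]. *)
have int0 i j k (a : {ffun J -> nat}) : a None = 0%N ->
    wedge12s A (fun i j => D i (A j) - D j (A i)) i j k a = 0.
  move=> a0; rewrite -(mi_projK a0) -sresE /wedge12s sresD sresB !sresM !sresB.
  by rewrite !sres_deriv !sresA -[LHS]/(wedge12s omega_series (fun i j =>
    sderiv i (omega_series j) - sderiv j (omega_series i)) i j k _) integrable.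
have flat i j : D i (A j) - D j (A i) = A i * Dt (A j) - A j * Dt (A i).
  have DtA k : Dt (A k) = X k.
    by rewrite /A sderivD sderivC sderivt_spham sderiv0 add0r DtC.
  rewrite !DtA; apply: (unfolding_flat pr1 pr2 pr3 n12 n13 n23 DtC) => //.
  by move=> k; exact: Cof_ord.
have MA_ge0 : 0 <= MA by exact: bnd_ge0 (MAb i1).
(* The summands give [2 * rho' <= rho] and make the operator [T] below send the ball of radius 2
   into the unit ball. *)
pose rho' := (2 / rho + 2 * n * MA / tau)^-1.
have den4 : 0 < 2 / rho by rewrite divr_gt0.
have den5 : 0 <= 2 * n * MA / tau by apply: divr_ge0; [apply: mulr_ge0 => //;
  exact: mulr_ge0|exact: ltW].
have den45 : 0 < 2 / rho + 2 * n * MA / tau by rewrite ltr_wpDr.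
have [rho'_gt0 rho'_le1 rho'_small] := inv_add_le1 (ltW den4) den5 den45.
rewrite -/rho' in rho'_gt0 rho'_le1 rho'_small.
have rho'_le : 2 * rho' <= rho.
  by move: rho'_le1; rewrite mulrA ler_pdivrMr// mul1r mulrC.
pose W := @fwt I R rho' tau.
have Ab i : bnd W (A i) MA.
  by apply: bnd_uwt_fwt (MAb i) => //; exact: ltW.
(* The unknown is [G = Dt F], for which transport reads [G = 1 + T G] with [T] bounded; as an
   equation for [F] it would contain the unbounded [Dt]. The type [unit] turns one series into a
   family for [series_fixpoint]. *)
pose T (G : S) : S := Dt (rinv (radial A * G)).
pose Psi (G : unit -> S) : unit -> S := fun u => 1 + T (G u).
have TB G H : T G - T H = T (G - H).
  by rewrite /T -sderivB /rinv -sreindexB mulrBr.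
have Psi_contr N (G H : unit -> S) :
    (forall u, ord (@xweight I) N (G u - H u)) ->
    forall u, ord (@xweight I) N.+1 (Psi G u - Psi H u).
  move=> GH u; rewrite /Psi.
  have -> : 1 + T (G u) - (1 + T (H u)) = T (G u - H u) by rewrite -TB; ring.
  rewrite -[N.+1]subn0; apply: (@ord_sderiv _ _ (@xweight I) _ None).
  apply: (@ord_sreindex _ _ _ _ _ (@xweight I) (@xweight I) N.+1) => //.
  by rewrite -add1n -[1%N]addn0; apply: ordM => //; rewrite -[radial A]mulr1;
    exact: ord_radial.
have W0 := fwt_ge0 (I := I) rho'_gt0 tau_gt0.
have WD := fwtD (I := I) rho'_gt0 tau_gt0.
have Tb G : bnd W G 2 -> bnd W (T G) 1.
  move=> Gb; have -> : T G = \sum_i Dt (rinv (smono R (ex i) * (A i * G))).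
    rewrite /T /radial mulr_suml -sderiv_sum; congr sderiv.
    have r0 : rinv (0 : S) = 0 by exact: sreindex0.
    under eq_bigr do rewrite -mulrA.
    by elim/big_ind2 : _ => // f f' g g' <- <-; exact: sreindexD.
  have ib i : bnd W (Dt (rinv (smono R (ex i) * (A i * G)))) (rho' / tau * (MA * 2)).
    by apply: bnd_deriv_rinv => //; exact: bndM.
  apply: bnd_le (bnd_sum W0 _ (fun i _ => ib i)).
  rewrite sumr_const; apply: le_trans rho'_small.
  by rewrite le_eqVlt; apply/orP; left; apply/eqP; rewrite -[LHS]mulr_natl -/n; ring.
have bnd1 : bnd W (1 : S) 1.
  rewrite -(@smono0 J R); apply: bnd_le (bnd_smono W0 _).
  by rewrite /fwt weight0 mi0 !expr0 mulr1 mul1r invbin_le1.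
have [G0 [GE Git]] := series_fixpoint Psi_contr.
pose G := G0 tt.
have Gb : bnd W G 2.
  apply: (@bnd_approx _ _ _ (@xweight I)) => N.
  exists (iter N Psi (fun=> 0) tt); split; first exact: Git.
  elim: N {Git} tt => [|N IH] u; first by apply: bnd_le (bnd0 _).
  by rewrite iterS; apply: bndD => //; exact: Tb.
have {}GE : G = 1 + T G by rewrite /G -{1}GE.
(* [t] is the initial value on [x = 0]: [euler] annihilates it, and it contributes the 1 in
   [G = 1 + T G]. *)
pose F : S := smono R (unit_mi None) + rinv (radial A * G).
have DtF : Dt F = G.
  rewrite GE /F sderivD; congr (_ + _).
  by rewrite -[unit_mi None]mulr1n sderiv_smono_unit eqxx mulr0n mulr1n smono0.
have transport : euler F = radial A * Dt F.
  rewrite DtF /F; apply/funext => a.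
  have -> : euler F = euler (rinv (radial A * G)).
    apply/funext => b; rewrite !eulerE /F serD mulrnDl {1}/smono.
    case: eqP => [->|_]; last by rewrite mul0rn add0r.
    by rewrite xdeg_et !mulr0n addr0.
  by rewrite euler_rinv//; exact: ord_radial.
have DF := frobenius_transport flat transport.
have [MF Fb] : exists MF, bnd W F MF.
  exists (W (unit_mi None) + \sum_(i : I) W (ex i) * MA * 2).
  apply: bndD => //; first exact: bnd_smono.
  apply: bnd_rinv => //; rewrite /radial mulr_suml; apply: bnd_sum => // i _.
  by apply: bndM => //; apply: bndM => //; exact: bnd_smono.
exists rho', (Num.max MF 2), (sres F), (sres G); split.
- by [].
- apply: (bnd_sres (tau := tau)); apply: bnd_le Fb. by rewrite le_max lexx.
- apply: (bnd_sres (tau := tau)); apply: bnd_le Gb. by rewrite le_max lexx orbT.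
- by move=> i; rewrite -sres_deriv DF sresM sresA DtF.
- rewrite sresE GE serD ser1.
  have -> : mi_lift (0 : {ffun I -> nat}) = 0 by apply/ffunP => -[i|]; rewrite !ffunE.
  rewrite eqxx /T /sderiv /rinv /sreindex add0r xdeg_et invr0 mul0r mul0rn addr0.
  by [].
Qed.

End Existence.

(** * Unordered sums and evaluation of power series *)

Section HasSum.
Variable R : realType.

(** The summation clause of [analytic_at], for an arbitrary index type. *)
Definition has_sum (T : choiceType) (u : T -> R) (l : R) : Prop :=
  let t := fun a => (u a)%:E in
  summable setT t /\
  l%:E = (\esum_(a in setT) (t^\+)%E a - \esum_(a in setT) (t^\-)%E a)%E.

Lemma esum_ge0_fin (T : choiceType) (p : T -> R) : (forall a, 0 <= p a) ->
  summable setT (fun a => (p a)%:E) ->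
  \esum_(a in setT) (p a)%:E = (fine (\esum_(a in setT) (p a)%:E))%:E.
Proof.
move=> p0 sp; rewrite fineK// (_ : esum _ _ = \esum_(a in setT) `|(p a)%:E|%E).
  by rewrite -(@summableE _ _ setT (fun a => (p a)%:E)).
by apply: eq_esum => a _; rewrite gee0_abs// lee_fin.
Qed.

(** Any decomposition into summable nonnegative families computes the sum, not only that into
    positive and negative parts. The rules for sums, multiples, reindexing and rows rest on this
    freedom. *)
Lemma has_sum_posneg (T : choiceType) (p n u : T -> R) (P N : R) :
  (forall a, 0 <= p a) -> (forall a, 0 <= n a) ->
  \esum_(a in setT) (p a)%:E = P%:E -> \esum_(a in setT) (n a)%:E = N%:E ->
  (forall a, u a = p a - n a) -> has_sum u (P - N).
Proof.
move=> p0 n0 eP eN upn.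
have su (q : T -> R) Q : (forall a, 0 <= q a) -> \esum_(a in setT) (q a)%:E = Q%:E ->
    summable setT (fun a => (q a)%:E).
  move=> q0 eQ; rewrite /summable (_ : esum _ _ = \esum_(a in setT) (q a)%:E).
    by rewrite eQ ltry.
  by apply: eq_esum => a _; rewrite gee0_abs// lee_fin.
have sp := su _ _ p0 eP; have sn := su _ _ n0 eN.
have -> : u = (fun a => p a - n a) by apply/funext.
split; first exact: summableB sp sn.
rewrite EFinB -eP -eN.
by symmetry; apply: (esumB sp sn) => a _; rewrite lee_fin.
Qed.

Lemma has_sum_uniq (T : choiceType) (u : T -> R) l k : has_sum u l ->
  has_sum u k -> l = k.
Proof. by move=> [_ lE] [_ kE]; apply/EFin_inj; rewrite lE kE. Qed.

Lemma summable_has_sum (T : choiceType) (u : T -> R) :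
  summable setT (fun a => (u a)%:E) -> exists p n : T -> R, exists P N : R,
  [/\ forall a, 0 <= p a /\ 0 <= n a, \esum_(a in setT) (p a)%:E = P%:E,
      \esum_(a in setT) (n a)%:E = N%:E,
      forall a, u a = p a - n a & forall a, p a <= `|u a| /\ n a <= `|u a|].
Proof.
move=> su; pose p a := Num.max (u a) 0; pose n a := Num.max (- u a) 0.
have pu a : p a <= `|u a| by rewrite /p ge_max ler_norm normr_ge0.
have nu a : n a <= `|u a| by rewrite /n ge_max normr_ge0 andbT -normrN ler_norm.
have sub (q : T -> R) : (forall a, 0 <= q a) -> (forall a, q a <= `|u a|) ->
    summable setT (fun a => (q a)%:E).
  move=> q0 qu; apply: le_lt_trans su; apply: le_esum => a _.
  by rewrite lee_fin ger0_norm.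
have p0 a : 0 <= p a by rewrite /p le_max lexx orbT.
have n0 a : 0 <= n a by rewrite /n le_max lexx orbT.
exists p, n, (fine (\esum_(a in setT) (p a)%:E)), (fine (\esum_(a in setT) (n a)%:E)).
split=> //.
- by apply: esum_ge0_fin => //; exact: sub.
- by apply: esum_ge0_fin => //; exact: sub.
- move=> a; rewrite /p /n; have [u0|u0] := leP 0 (u a).
    by rewrite max_r ?oppr_le0 ?subr0.
  by rewrite max_l ?sub0r ?opprK// oppr_ge0 ltW.
Qed.

Lemma has_sum_ex (T : choiceType) (u : T -> R) :
  summable setT (fun a => (u a)%:E) -> exists l, has_sum u l.
Proof.
move=> /summable_has_sum[p [n [P [N [pn eP eN upn _]]]]].
by exists (P - N); apply: has_sum_posneg eP eN upn => a; have [] := pn a.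
Qed.

Lemma has_sum_ge0 (T : choiceType) (u : T -> R) l : (forall a, 0 <= u a) ->
  has_sum u l -> \esum_(a in setT) (u a)%:E = l%:E.
Proof.
move=> u0 ul; have [su _] := ul; have eL := esum_ge0_fin u0 su.
rewrite eL; congr EFin; apply: has_sum_uniq ul; rewrite -[X in has_sum _ X]subr0.
apply: (@has_sum_posneg _ u (fun=> 0)) => // [|a]; last by rewrite subr0.
by rewrite esum1.
Qed.

Lemma has_sum_decomp (T : choiceType) (u : T -> R) l : has_sum u l ->
  exists p n : T -> R, exists P N : R,
  [/\ forall a, 0 <= p a /\ 0 <= n a, \esum_(a in setT) (p a)%:E = P%:E,
      \esum_(a in setT) (n a)%:E = N%:E,
      forall a, u a = p a - n a & l = P - N /\ forall a,
        p a <= `|u a| /\ n a <= `|u a|].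
Proof.
move=> ul; have [su _] := ul.
have [p [n [P [N [pn eP eN upn pu]]]]] := summable_has_sum su.
exists p, n, P, N; split=> //; split=> //.
apply: has_sum_uniq ul _.
by apply: has_sum_posneg eP eN upn => a; have [] := pn a.
Qed.

Lemma has_sumD (T : choiceType) (u v : T -> R) l k :
  has_sum u l -> has_sum v k -> has_sum (fun a => u a + v a) (l + k).
Proof.
move=> /has_sum_decomp[p [n [P [N [pn eP eN upn [-> _]]]]]].
move=> /has_sum_decomp[p' [n' [P' [N' [pn' eP' eN' upn' [-> _]]]]]].
have -> : P - N + (P' - N') = (P + P') - (N + N') by ring.
apply: (@has_sum_posneg _ (fun a => p a + p' a) (fun a => n a + n' a)).
- by move=> a; have [? _] := pn a; have [? _] := pn' a; exact: addr_ge0.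
- by move=> a; have [_ ?] := pn a; have [_ ?] := pn' a; exact: addr_ge0.
- rewrite EFinD -eP -eP' -esumD//.
  + by move=> a _; have [? _] := pn a; rewrite lee_fin.
  + by move=> a _; have [? _] := pn' a; rewrite lee_fin.
- rewrite EFinD -eN -eN' -esumD//.
  + by move=> a _; have [_ ?] := pn a; rewrite lee_fin.
  + by move=> a _; have [_ ?] := pn' a; rewrite lee_fin.
- by move=> a; rewrite upn upn'; ring.
Qed.

Lemma has_sumN (T : choiceType) (u : T -> R) l : has_sum u l -> has_sum (fun a =>
  - u a) (- l).
Proof.
move=> /has_sum_decomp[p [n [P [N [pn eP eN upn [-> _]]]]]].
rewrite opprB; apply: has_sum_posneg eN eP _ => a; [| |by rewrite upn opprB].
  by have [] := pn a.
by have [] := pn a.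
Qed.

(** One inequality suffices: the reverse one is the same inequality for [k^-1] and the family
    [k * p]. *)
Lemma esumZ_fin (T : choiceType) (p : T -> R) (k P : R) : (forall a, 0 <= p a) ->
  0 <= k ->
  \esum_(a in setT) (p a)%:E = P%:E -> \esum_(a in setT) (k * p a)%:E = (k * P)%:E.
Proof.
move=> p0 k0 eP.
have le_esumZ (q : T -> R) (c Q : R) : (forall a, 0 <= q a) -> 0 <= c ->
    \esum_(a in setT) (q a)%:E = Q%:E -> (\esum_(a in setT) (c * q a)%:E <=
      (c * Q)%:E)%E.
  move=> q0 c0 eQ; apply: ge_ereal_sup => /= _ [X [fX _] <-].
  rewrite fsbig_finite//= sumEFin lee_fin -mulr_sumr ler_wpM2l// -lee_fin -eQ.
  rewrite -sumEFin; apply: esum_ge; exists X => //.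
  by rewrite fsbig_finite.
have [->|kn0] := eqVneq k 0.
  by rewrite mul0r esum1// => a _; rewrite mul0r.
apply/eqP; rewrite eq_le le_esumZ//=.
have skp : summable setT (fun a => (k * p a)%:E).
  rewrite /summable (_ : esum _ _ = \esum_(a in setT) (k * p a)%:E).
    by apply: le_lt_trans (le_esumZ _ _ _ p0 k0 eP) _; rewrite ltry.
  by apply: eq_esum => a _; rewrite gee0_abs// lee_fin mulr_ge0.
have kp0 a : 0 <= k * p a by rewrite mulr_ge0.
have eQ := esum_ge0_fin kp0 skp; set Q := fine _ in eQ.
rewrite eQ lee_fin.
have ki : 0 <= k^-1 by rewrite invr_ge0.
have := le_esumZ _ _ _ kp0 ki eQ.
rewrite (_ : esum _ _ = P%:E); last first.
  by rewrite -eP; apply: eq_esum => a _; rewrite mulKf.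
rewrite lee_fin => PQ.
by rewrite -(@ler_pM2l _ k^-1) ?mulKf// invr_gt0 lt_def kn0.
Qed.

Lemma has_sumZ (T : choiceType) (u : T -> R) k l :
  has_sum u l -> has_sum (fun a => k * u a) (k * l).
Proof.
wlog k0 : k / 0 <= k => [hw ul|].
  have [k0|k0] := leP 0 k; first exact: hw.
  have := has_sumN (hw (- k) _ ul); rewrite oppr_ge0 ltW// => /(_ isT).
  rewrite mulNr opprK; congr has_sum; apply/funext => a; by rewrite mulNr opprK.
move=> /has_sum_decomp[p [n [P [N [pn eP eN upn [-> _]]]]]].
rewrite mulrBr.
apply: (@has_sum_posneg _ (fun a => k * p a) (fun a => k * n a)).
- by move=> a; have [? _] := pn a; exact: mulr_ge0.
- by move=> a; have [_ ?] := pn a; exact: mulr_ge0.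
- by apply: esumZ_fin => // a; have [] := pn a.
- by apply: esumZ_fin => // a; have [] := pn a.
- by move=> a; rewrite upn mulrBr.
Qed.

Lemma has_sum0 (T : choiceType) : has_sum (fun _ : T => 0) 0.
Proof.
rewrite -{2}(subrr 0); apply: (@has_sum_posneg _ (fun=> 0) (fun=> 0)) => //.
- by rewrite esum1.
- by rewrite esum1.
- by move=> a; rewrite subrr.
Qed.

Lemma has_sum1 (T : choiceType) (b : T) r : has_sum (fun a =>
  if a == b then r else 0) r.
Proof.
suff H : has_sum (fun a => if a == b then 1 else 0) 1.
  have := has_sumZ r H; rewrite mulr1; congr has_sum; apply/funext => a.
  by case: eqP; rewrite ?mulr1 ?mulr0.
rewrite -{2}[1]subr0.
apply: (@has_sum_posneg _ (fun a => if a == b then 1 else 0) (fun=> 0)) => //.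
- by move=> a; case: eqP.
- rewrite -[RHS](@esum_set1 _ _ b (fun=> 1%E))// [RHS]esum_mkcond.
  by apply: eq_esum => a _; case: eqP => [->|ab]; [rewrite mem_set|rewrite memNset].
- by rewrite esum1.
- by move=> a; rewrite subr0.
Qed.

Lemma has_sum_finite (T : choiceType) (s : seq T) (u : T -> R) : uniq s ->
  (forall a, a \notin s -> u a = 0) -> has_sum u (\sum_(a <- s) u a).
Proof.
elim: s u => [|b s IH] u.
  move=> _ u0; rewrite big_nil; have -> : u = (fun=> 0) by apply/funext => a; exact: u0.
  exact: has_sum0.
move=> /= /andP[bs us] u0; rewrite big_cons.
pose v a := if a == b then 0 else u a.
have vs : \sum_(a <- s) u a = \sum_(a <- s) v a.
  apply: eq_big_seq => a sa; rewrite /v; case: eqP => // ab.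
  by rewrite -ab sa in bs.
rewrite vs [X in has_sum X](_ : u = fun a => (if a == b then u b else 0) + v a).
  apply: has_sumD; first exact: has_sum1.
  apply: IH => // a sa; rewrite /v; case: eqP => // /eqP ab.
  by rewrite u0// inE negb_or ab.
by apply/funext => a; rewrite /v; case: eqP => [->|]; rewrite ?addr0 ?add0r.
Qed.

Lemma has_sum_inject (T T' : choiceType) (phi : T -> T') (u : T -> R) (u' : T' -> R) l :
  injective phi -> (forall a, u' (phi a) = u a) ->
  (forall b, (forall a, b <> phi a) -> u' b = 0) -> has_sum u' l -> has_sum u l.
Proof.
move=> phiI uu u0 /has_sum_decomp[p [n [P [N [pn eP eN upn [-> pu]]]]]].
have esum_phi (q : T' -> R) : (forall b, q b <= `|u' b|) -> (forall b, 0 <= q b) ->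
    \esum_(a in setT) (q (phi a))%:E = \esum_(b in setT) (q b)%:E.
  move=> qu q0; rewrite -(@esum_image _ _ _ setT phi (fun b => (q b)%:E)); last first.
    by move=> a b _ _; exact: phiI.
  rewrite esum_mkcond; apply: eq_esum => b _; case: ifPn => // /negP nb.
  congr EFin; apply/esym/eqP; rewrite eq_le q0 andbT (le_trans (qu b))//.
  by rewrite u0 ?normr0// => a ba; apply: nb; rewrite inE/=; exists a.
apply: (@has_sum_posneg _ (p \o phi) (n \o phi)).
- by move=> a /=; have [] := pn (phi a).
- by move=> a /=; have [] := pn (phi a).
- by rewrite esum_phi// => b; [have [] := pu b|have [] := pn b].
- by rewrite esum_phi// => b; [have [] := pu b|have [] := pn b].
- by move=> a; rewrite -uu upn.
Qed.

Lemma has_sum_extend (T T' : choiceType) (phi : T -> T') (u : T -> R) (u' : T' -> R) l :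
  injective phi -> (forall a, u' (phi a) = u a) ->
  (forall b, (forall a, b <> phi a) -> u' b = 0) -> has_sum u l -> has_sum u' l.
Proof.
move=> phiI uu u0 ul; have [su _] := ul.
suff su' : summable setT (fun b => (u' b)%:E).
  have [k uk] := has_sum_ex su'.
  by rewrite (has_sum_uniq ul (has_sum_inject phiI uu u0 uk)).
apply: le_lt_trans su; under [leRHS]eq_esum do rewrite -uu.
rewrite -(@esum_image _ _ _ setT phi (fun b => `|(u' b)%:E|%E)); last first.
  by move=> a b _ _; exact: phiI.
rewrite [leRHS]esum_mkcond; apply: le_esum => b _; case: ifPn => // /negP nb.
by rewrite u0 ?abse0// => a ba; apply: nb; rewrite inE/=; exists a.
Qed.

(** Fubini for unordered sums, applied to the two nonnegative parts separately; being bounded by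
    [|u|], these have finite row sums. *)
Lemma has_sum_sigma (T T' : choiceType) (u : T * T' -> R) (v : T -> R) l :
  has_sum u l -> (forall i, has_sum (fun j => u (i, j)) (v i)) -> has_sum v l.
Proof.
move=> /has_sum_decomp[p [n [P [N [pn eP eN upn [-> pu]]]]]] uv.
have [suv _] := all_and2 uv.
have rows (q : T * T' -> R) Q : (forall a, 0 <= q a) -> (forall a, q a <= `|u a|) ->
    \esum_(a in setT) (q a)%:E = Q%:E -> exists q' : T -> R,
    [/\ forall i, 0 <= q' i, forall i, \esum_(j in setT) (q (i, j))%:E = (q' i)%:E &
       \esum_(i in setT) (q' i)%:E = Q%:E].
  move=> q0 qu eQ; exists (fun i => fine (\esum_(j in setT) (q (i, j))%:E)).
  have fq i : \esum_(j in setT) (q (i, j))%:E = (fine (\esum_(j in setT) (q (i,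
    j))%:E))%:E.
    apply: esum_ge0_fin => //; apply: le_lt_trans (suv i).
    by apply: le_esum => j _; rewrite lee_fin ger0_norm.
  split=> // [i|].
    by apply: fine_ge0; apply: esum_ge0 => j _; rewrite lee_fin.
  rewrite -eQ; under eq_esum do rewrite -fq.
  rewrite (@esum_esum _ _ _ setT (fun=> setT) (fun i j => (q (i, j))%:E)); last first.
    by move=> i j _ _; rewrite lee_fin.
  rewrite (_ : setT `*`` (fun=> setT) = setT); last by apply/seteqP; split.
  by apply: eq_esum => -[i j] _.
have [p' [p'0 ep' sp']] := rows p P (fun a => proj1 (pn a)) (fun a => proj1 (pu a)) eP.
have [n' [n'0 en' sn']] := rows n N (fun a => proj2 (pn a)) (fun a => proj2 (pu a)) eN.
apply: has_sum_posneg sp' sn' _ => // i.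
apply: has_sum_uniq (uv i) _.
by apply: has_sum_posneg (ep' i) (en' i) _ => // j; have [] := pn (i, j).
Qed.

Lemma summable_sigma (T T' : choiceType) (u : T * T' -> R) (v : T -> R) M :
  (forall i, has_sum (fun j => `|u (i, j)|) (v i)) ->
  \esum_(i in setT) (v i)%:E = M%:E -> summable setT (fun a => (u a)%:E).
Proof.
move=> uv eM; rewrite /summable.
rewrite (_ : esum _ _ = M%:E) ?ltry// -eM.
transitivity (\esum_(i in setT) \esum_(j in setT) `|(u (i, j))%:E|%E).
  rewrite (@esum_esum _ _ _ setT (fun=> setT) (fun i j => `|(u (i, j))%:E|%E))//.
  rewrite (_ : setT `*`` (fun=> setT) = setT); last by apply/seteqP; split.
  by apply: eq_esum => -[i j] _.
by apply: eq_esum => i _; rewrite -(has_sum_ge0 _ (uv i)).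
Qed.

End HasSum.

(** * Evaluation, products and recentring of power series *)

Section Evaluation.
Variables (R : realType) (n : nat).
Local Notation S := (series 'I_n R).
Local Notation mi := {ffun 'I_n -> nat}.
Implicit Types (x y : 'rV[R]_n) (f g c : S) (a b : mi).

Lemma monomialD x a b : monomial x (a + b) = monomial x a * monomial x b.
Proof. by rewrite /monomial -big_split; apply: eq_bigr => i _; rewrite miD exprD. Qed.

Lemma monomial0 x : monomial x 0 = 1.
Proof. by rewrite /monomial big1// => i _; rewrite mi0. Qed.

Lemma monomial_unit x i k : monomial x (unit_mi i *+ k) = x ord0 i ^+ k.
Proof.
rewrite /monomial (bigD1 i)//= miMn unit_miE eqxx mul1n big1 ?mulr1// => j ji.
by rewrite miMn unit_miE (negPf ji).
Qed.

Lemma monomial_const (rho : R) a : monomial (const_mx rho) a = pweight rho a.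
Proof.
rewrite /monomial /pweight /weight -prodrXr; apply: eq_bigr => i _.
by rewrite mxE mul1n.
Qed.

Lemma le_monomial (rho : R) x a : (forall i, `|x ord0 i| <= rho) ->
  `|monomial x a| <= pweight rho a.
Proof.
move=> xr; rewrite -monomial_const /monomial normr_prod; apply: ler_prod => i _.
by rewrite normr_ge0 mxE normrX lerXn2r// nnegrE// (le_trans _ (xr i)).
Qed.

Definition mi_bin a b : R := \prod_i 'C(a i, b i)%:R.

Lemma mi_bin_ge0 a b : 0 <= mi_bin a b.
Proof. exact: prodr_ge0. Qed.

(** A product of binomial expansions. The inner sums are widened to the common range that [below]
    uses, so that after distribution both sides run over the same finite functions. *)
Lemma monomial_addr x y a : monomial (x + y) a =
  \sum_(b <- below a) mi_bin a b * monomial x (mi_sub a b) * monomial y b.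
Proof.
pose N := (weight (fun=> 1%N) a).
pose F i (j : 'I_N.+1) := 'C(a i, j)%:R * x ord0 i ^+ (a i - j) * y ord0 i ^+ j.
transitivity (\prod_i \sum_j F i j).
  apply: eq_bigr => i _; rewrite mxE exprDn.
  have aN : (a i <= N)%N by rewrite leq_weight.
  rewrite (big_ord_widen N.+1 (fun k =>
    (x ord0 i ^+ (a i - k) * y ord0 i ^+ k) *+ 'C(a i, k)))//.
  rewrite [RHS](bigID (fun j : 'I_N.+1 => (j < (a i).+1)%N))/= [X in _ + X]big1 ?addr0.
    by apply: eq_bigr => j _; rewrite /F -mulrA mulr_natl.
  by move=> j; rewrite -leqNgt => ja; rewrite /F bin_small// !mul0r.
rewrite bigA_distr_bigA /= /below big_filter -/N big_map big_enum_cond /=.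
rewrite [RHS]big_mkcond /=; apply: eq_bigr => h _.
case: ifPn => [ha|/forallPn[i]].
  rewrite /mi_bin /monomial -!big_split /=; apply: eq_bigr => i _.
  by rewrite /F !ffunE.
by rewrite ffunE -ltnNge => ai; rewrite (bigD1 i)//= /F bin_small// !mul0r.
Qed.

Lemma summable_uniq (T : choiceType) (u : T -> R) M :
  (forall s, uniq s -> \sum_(t <- s) `|u t| <= M) -> summable setT (fun t => (u t)%:E).
Proof.
move=> uM; apply: (@le_lt_trans _ _ M%:E); last exact: ltry.
apply: ge_ereal_sup => /= _ [X [fX _] <-].
by rewrite fsbig_finite//= sumEFin lee_fin uM.
Qed.

Lemma summable_bound (T : choiceType) (u : T -> R) :
  summable setT (fun t => (u t)%:E) -> exists M,
  forall s, uniq s -> \sum_(t <- s) `|u t| <= M.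
Proof.
move=> su; exists (fine (\esum_(t in setT) `|(u t)%:E|%E)) => s us.
rewrite -lee_fin fineK; last by rewrite -summableE.
rewrite -sumEFin; apply: esum_ge; exists [set` s].
  by split => //; exact: finite_seq.
rewrite fsbig_seq//.
Qed.

Definition sev c x : R :=
  let t := fun a => (c a * monomial x a)%:E in
  fine (\esum_(a in setT) (t^\+)%E a - \esum_(a in setT) (t^\-)%E a).

Lemma sev_uniq c x l : has_sum (fun a => c a * monomial x a) l -> sev c x = l.
Proof. by move=> [_ lE]; apply: EFin_inj; rewrite /sev -lE. Qed.

Section Ball.
Variable rho : R.

Lemma bnd_list c M x : bnd (pweight rho) c M -> (forall i, `|x ord0 i| <= rho) ->
  forall s, uniq s -> \sum_(a <- s) `|c a * monomial x a| <= M.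
Proof.
move=> cM xr s us; apply: le_trans (cM _ us); apply: ler_sum => a _.
by rewrite normrM ler_wpM2l// le_monomial.
Qed.

Lemma bnd_summable c M x : bnd (pweight rho) c M -> (forall i, `|x ord0 i| <= rho) ->
  summable setT (fun a => (c a * monomial x a)%:E).
Proof. by move=> cM xr; apply: summable_uniq; exact: bnd_list cM xr. Qed.

Lemma has_sum_sev c M x : bnd (pweight rho) c M -> (forall i, `|x ord0 i| <= rho) ->
  has_sum (fun a => c a * monomial x a) (sev c x).
Proof.
move=> cM xr; have [l cl] := has_sum_ex (bnd_summable cM xr).
by rewrite (sev_uniq cl).
Qed.

Lemma sevD f g M N x : bnd (pweight rho) f M -> bnd (pweight rho) g N ->
  (forall i, `|x ord0 i| <= rho) -> sev (f + g) x = sev f x + sev g x.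
Proof.
move=> fM gN xr; apply: sev_uniq.
have := has_sumD (has_sum_sev fM xr) (has_sum_sev gN xr).
by congr has_sum; apply/funext => a; rewrite serD mulrDl.
Qed.

Lemma sevN f M x : bnd (pweight rho) f M ->
  (forall i, `|x ord0 i| <= rho) -> sev (- f) x = - sev f x.
Proof.
move=> fM xr; apply: sev_uniq.
have := has_sumN (has_sum_sev fM xr).
by congr has_sum; apply/funext => a; rewrite serN mulNr.
Qed.

Lemma has_sum_norm (T : choiceType) (u : T -> R) l : has_sum u l ->
  exists k, has_sum (fun t => `|u t|) k.
Proof.
move=> [su _]; apply: has_sum_ex; apply: le_lt_trans su; apply: le_esum => t _.
by rewrite lee_fin normr_id.
Qed.

Lemma has_sum_mul (T T' : choiceType) (u : T -> R) (v : T' -> R) l k :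
  has_sum u l -> has_sum v k -> has_sum (fun p : T * T' => u p.1 * v p.2) (l * k).
Proof.
move=> ul vk; have [l' ul'] := has_sum_norm ul; have [k' vk'] := has_sum_norm vk.
have k'0 : 0 <= k'.
  rewrite -lee_fin -(has_sum_ge0 _ vk')//; apply: esum_ge0 => a _.
  by rewrite lee_fin.
have [m um] : exists m, has_sum (fun p : T * T' => u p.1 * v p.2) m.
  apply: has_sum_ex.
  apply: (@summable_sigma _ _ _ _ (fun i => k' * `|u i|) (k' * l')).
    move=> i; rewrite mulrC; have := has_sumZ `|u i| vk'.
    by congr has_sum; apply/funext => j; rewrite normrM.
  by apply: esumZ_fin => //; exact: has_sum_ge0.
suff <- : m = l * k by [].
apply: has_sum_uniq (_ : has_sum (fun i => k * u i) m) _; last first.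
  by rewrite mulrC; exact: has_sumZ.
apply: (has_sum_sigma um) => i /=.
by have := has_sumZ (u i) vk; rewrite [u i * k]mulrC.
Qed.

(** The product family, indexed by pairs [(b, c)], is reindexed by [(b + c, b)], extended by 0 to
    all pairs and summed by rows. *)
Lemma sevM f g M N x : bnd (pweight rho) f M -> bnd (pweight rho) g N ->
  (forall i, `|x ord0 i| <= rho) -> sev (f * g) x = sev f x * sev g x.
Proof.
move=> fM gN xr; apply: sev_uniq.
have fg := has_sum_mul (has_sum_sev fM xr) (has_sum_sev gN xr).
pose u (p : mi * mi) := if mi_le p.2 p.1
  then f p.2 * g (mi_sub p.1 p.2) * monomial x p.1 else 0.
have ul : has_sum u (sev f x * sev g x).
  apply: (has_sum_extend (phi := fun p : mi * mi => (p.1 + p.2, p.1))) fg.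
  - move=> [b c] [b' c'] /= e; have e2 := congr1 snd e; have e1 := congr1 fst e.
    by rewrite /= in e1 e2; rewrite e2 in e1 *; rewrite (mi_addIl e1).
  - by move=> [b c]; rewrite /u /= mi_leDl mi_addKl monomialD; ring.
  - move=> [a b] ab; rewrite /u /=; case: ifP => // ba.
    by have := ab (b, mi_sub a b); rewrite /= mi_subKr.
apply: has_sum_sigma ul _ => a; rewrite serM mulr_suml.
rewrite [X in has_sum _ X](_ : _ = \sum_(b <- below a) u (a, b)).
  apply: has_sum_finite; first exact: below_uniq.
  by move=> b; rewrite mem_below /u /= => /negPf ->.
by apply: eq_big_seq => b; rewrite mem_below /u /= => ->.
Qed.

End Ball.

Lemma sev_smono b x : sev (smono R b) x = monomial x b.
Proof.
apply: sev_uniq; have := has_sum1 b (monomial x b).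
congr has_sum; apply/funext => a; rewrite /smono.
by case: eqP => [->|_]; rewrite ?mul1r ?mul0r.
Qed.

Lemma sev_at0 c : sev c 0 = c 0.
Proof.
apply: sev_uniq; have := has_sum1 (0 : mi) (c 0).
congr has_sum; apply/funext => a; case: eqP => [->|a0].
  by rewrite monomial0 mulr1.
have [i ai] : exists i, (0 < a i)%N.
  apply: contrapT => /forallNP ai; apply: a0; apply/ffunP => i.
  by rewrite ffunE; have /negP := ai i; rewrite -eqn0Ngt => /eqP.
by rewrite /monomial (bigD1 i)//= mxE expr0n eqn0Ngt ai /= mul0r mulr0.
Qed.

(** Taylor expansion at [x]. The double family is absolutely summable, since its rows of absolute
    values add up to [|c a|] times the monomial [a] at the point with entries [|x_i| + delta], so
    the order of summation may be exchanged. The third clause identifies the new coefficients. *)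
Lemma recenter (rho delta : R) c M x : 0 < delta -> bnd (pweight rho) c M ->
  (forall i, `|x ord0 i| + delta <= rho) ->
  exists (c' : S) M', [/\ bnd (pweight delta) c' M',
    forall y, (forall i, `|y ord0 i| <= delta) ->
      has_sum (fun b => c' b * monomial y b) (sev c (x + y)) &
    forall b, has_sum (fun a =>
      c a * (if mi_le b a then mi_bin a b * monomial x (mi_sub a b) else 0)) (c' b)].
Proof.
move=> delta0 cM xr.
pose w (a b : mi) := c a * (if mi_le b a then mi_bin a b * monomial x (mi_sub a b) else 0).
have row a y : has_sum (fun b => w a b * monomial y b) (c a * monomial (x + y) a).
  rewrite monomial_addr mulr_sumr.
  rewrite [X in has_sum _ X](_ : _ = \sum_(b <- below a) w a b * monomial y b).
    apply: has_sum_finite; first exact: below_uniq.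
    by move=> b; rewrite mem_below /w => /negPf ->; rewrite mulr0 mul0r.
  by apply: eq_big_seq => b; rewrite mem_below /w => ->; rewrite mulrA.
pose ax : 'rV[R]_n := \row_i `|x ord0 i|.
have axm a : monomial ax a = `|monomial x a|.
  by rewrite /monomial normr_prod; apply: eq_bigr => i _; rewrite mxE normrX.
have axr y : (forall i, `|y ord0 i| <= delta) -> forall i, `|(ax + y) ord0 i| <= rho.
  move=> yd i; rewrite !mxE; apply: le_trans (xr i).
  by rewrite (le_trans (ler_normD _ _))// normr_id lerD2l.
have rowabs a : has_sum (fun b => `|w a b| * pweight delta b)
    (`|c a| * monomial (ax + const_mx delta) a).
  rewrite monomial_addr mulr_sumr.
  rewrite [X in has_sum _ X](_ : _ = \sum_(b <- below a) `|w a b| * pweight delta b).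
    apply: has_sum_finite; first exact: below_uniq.
    by move=> b; rewrite mem_below /w => /negPf ->; rewrite mulr0 normr0 mul0r.
  apply: eq_big_seq => b; rewrite mem_below /w => ->.
  by rewrite monomial_const axm !normrM (ger0_norm (mi_bin_ge0 _ _)) !mulrA.
have pw0 b : 0 <= pweight delta b by rewrite exprn_ge0// ltW.
have cd i : `|(const_mx delta : 'rV[R]_n) ord0 i| <=
  delta by rewrite mxE ger0_norm// ltW.
have dpos a : 0 <= monomial (ax + const_mx delta) a.
  by apply: prodr_ge0 => i _; rewrite exprn_ge0// !mxE addr_ge0// ltW.
have [L cL] : exists L, has_sum (fun a => `|c a| * monomial (ax + const_mx delta) a) L.
  have [L HL] := has_sum_norm (has_sum_sev cM (axr _ cd)).
  by exists L; move: HL; congr has_sum; apply/funext => a;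
    rewrite normrM (ger0_norm (dpos a)).
have sw : summable setT (fun p : mi * mi => (w p.1 p.2 * pweight delta p.2)%:E).
  apply: (@summable_sigma _ _ _ _ (fun a => `|c a| * monomial (ax +
    const_mx delta) a) L).
    move=> a; have := rowabs a; congr has_sum; apply/funext => b.
    by rewrite /= [RHS]normrM (ger0_norm (pw0 b)).
  by apply: has_sum_ge0 cL => a; rewrite mulr_ge0.
have [Mw swM] := summable_bound sw.
have /choice[c' c'P] : forall b, exists l, has_sum (fun a => w a b) l.
  move=> b; apply: has_sum_ex; apply: (@summable_uniq _ _ (Mw / pweight delta b)).
  move=> s us; rewrite ler_pdivlMr ?exprn_gt0// mulr_suml.
  have := swM [seq (a, b) | a <- s]; rewrite map_inj_uniq; last by move=> ? ? [].
  move=> /(_ us); rewrite big_map; apply: le_trans.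
  by apply: ler_sum => a _ /=; rewrite [leRHS]normrM (ger0_norm (pw0 b)).
have c'sum y : (forall i, `|y ord0 i| <= delta) ->
    has_sum (fun b => c' b * monomial y b) (sev c (x + y)).
  move=> yd.
  have [Ly wLy] : exists Ly, has_sum (fun p : mi * mi => w p.1 p.2 * monomial y p.2) Ly.
    apply: has_sum_ex; apply: le_lt_trans sw; apply: le_esum => p _.
    rewrite lee_fin !normrM ler_wpM2l// (ger0_norm (pw0 _)).
    exact: le_monomial.
  have -> : sev c (x + y) = Ly by apply: sev_uniq; exact: has_sum_sigma wLy (row ^~ y).
  have wLy' : has_sum (fun q : mi * mi => w q.2 q.1 * monomial y q.1) Ly.
    apply: (has_sum_inject (phi := fun q : mi * mi => (q.2, q.1))) wLy => //.
      by move=> [a b] [a' b'] [-> ->].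
    by move=> [a b] /(_ (b, a)).
  apply: has_sum_sigma wLy' _ => b /=; rewrite mulrC.
  have := has_sumZ (monomial y b) (c'P b).
  by congr has_sum; apply/funext => a; rewrite mulrC.
have [sc' _] := c'sum _ cd; have [M' c'M'] := summable_bound sc'.
exists c', M'; split=> // s us; apply: le_trans (c'M' _ us).
by apply: ler_sum => b _; rewrite normrM monomial_const (ger0_norm (pw0 b)).
Qed.

End Evaluation.

(** * Partial derivatives, uniqueness and analyticity of power series *)

Section Derivatives.
Variables (R : realType) (n : nat).
Local Notation S := (series 'I_n R).
Local Notation mi := {ffun 'I_n -> nat}.
Implicit Types (x y : 'rV[R]_n) (f g c : S) (a b : mi).

Lemma ball_rowP (e : R) x y : 0 < e ->
  ball x e y <-> forall i, `|x ord0 i - y ord0 i| < e.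
Proof.
move=> e0; split=> [[_ xy] i|xy].
  by have := xy ord0 i; rewrite /ball /= /ball_.
split=> // i j; rewrite ord1; exact: xy.
Qed.

Lemma ball0_rowP (e : R) x : 0 < e -> ball (0 : 'rV[R]_n) e x <-> forall i,
  `|x ord0 i| < e.
Proof.
move=> e0; rewrite ball_rowP//; split=> h i; have := h i; rewrite mxE sub0r normrN//.
Qed.

Lemma has_sum_le_norm (T : choiceType) (u : T -> R) l K : has_sum u l ->
  (forall s, uniq s -> \sum_(t <- s) `|u t| <= K) -> `|l| <= K.
Proof.
move=> ul uK; have [k uk] := has_sum_norm ul.
have kK : k <= K.
  rewrite -lee_fin -(has_sum_ge0 _ uk)//; apply: ge_ereal_sup => /= _ [X [fX _] <-].
  by rewrite fsbig_finite//= sumEFin lee_fin uK.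
have ge0 (v : T -> R) r : has_sum v r -> (forall t, 0 <= v t) -> 0 <= r.
  move=> vr v0; rewrite -lee_fin -(has_sum_ge0 v0 vr); apply: esum_ge0 => t _.
  by rewrite lee_fin.
have h1 := ge0 _ _ (has_sumD uk ul) _; have h2 := ge0 _ _ (has_sumD uk (has_sumN ul)) _.
rewrite ler_norml; apply/andP; split.
  rewrite lerNl; apply: le_trans kK; rewrite -subr_ge0 opprK; apply: h1 => t.
  by rewrite -lerBlDr sub0r -normrN ler_norm.
apply: le_trans kK; rewrite -subr_ge0; apply: h2 => t.
by rewrite subr_ge0 ler_norm.
Qed.

Lemma mi_bin_unit a i : mi_bin R (a + unit_mi i) (unit_mi i) = (a i).+1%:R.
Proof.
rewrite /mi_bin (bigD1 i)//= miD unit_miE eqxx addn1 bin1 big1 ?mulr1// => j ji.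
by rewrite unit_miE (negPf ji) bin0.
Qed.

Lemma bnd_sderiv_half rho M c i : 0 < rho -> bnd (pweight rho) c M ->
  bnd (pweight (rho / 2)) (sderiv i c) (rho^-1 * M).
Proof.
move=> rho0 cM.
have -> : sderiv i c = sreindex (fun a => (a i).+1%:R) (fun a => a + unit_mi i) c.
  by apply/funext => a; rewrite /sderiv /sreindex mulr_natl.
apply: bnd_reindex cM => [|a _|a b _ _ /mi_addIr//]; first by rewrite invr_ge0 ltW.
rewrite ger0_norm// /pweight weightD weight_unit addn1 exprS mulKf ?gt_eqF//.
rewrite expr_div_n mulrCA ler_piMr ?exprn_ge0 ?(ltW rho0)//.
rewrite ler_pdivrMr ?exprn_gt0// mul1r -natrX ler_nat.
by rewrite (leq_ltn_trans _ (ltn_expl _ (ltnSn 1)))// leq_weight.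
Qed.

(** After recentring at [x] the derivative is a coefficient of degree 1. Every term of degree at
    least 2 on the line in direction [i] is at most [(|h|/delta)^2] times its size at radius
    [delta], which bounds the remainder by a multiple of [h^2]. *)
Lemma partial_sev (rho delta : R) c M x i : 0 < delta -> bnd (pweight rho) c M ->
  (forall i, `|x ord0 i| + delta <= rho) ->
  partial i (sev c) x = sev (sderiv i c) x.
Proof.
move=> delta0 cM xr.
have [c' [M' [c'M' c'y c'a]]] := recenter delta0 cM xr.
have c'e : sev (sderiv i c) x = c' (unit_mi i).
  apply: sev_uniq; apply: has_sum_inject (c'a (unit_mi i)) => /=.
  - exact: (@mi_addIr _ (unit_mi i)).
  - by move=> a; rewrite mi_leDr mi_addK mi_bin_unit /sderiv -mulr_natr; ring.
  - move=> b bn; case: ifP => [ub|]; last by rewrite mulr0.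
    by case: (bn (mi_sub b (unit_mi i))); rewrite mi_subK.
have c'0 : sev c x = c' 0.
  rewrite -sev_at0; apply/esym/sev_uniq; rewrite -{1}[x]addr0; apply: c'y => j.
  by rewrite mxE normr0 ltW.
rewrite c'e /partial /derive.
have M'0 : 0 <= M' by exact: bnd_ge0 c'M'.
have key h : `|h| <= delta ->
    `|sev c (x + h *: delta_mx ord0 i) - c' 0 - h * c' (unit_mi i)| <=
      (`|h| / delta) ^+ 2 * M'.
  move=> hd; set y := h *: _.
  have yi j : y ord0 j = h *+ (j == i).
    by rewrite /y !mxE eqxx /=; case: eqP => _; rewrite ?mulr1 ?mulr0.
  have yd j : `|y ord0 j| <= delta.
    by rewrite yi; case: eqP => _//; rewrite mulr0n normr0 ltW.
  pose v b := c' b * monomial y b.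
  have vs : has_sum v (sev c (x + y)) by exact: c'y.
  have v0 : v 0 = c' 0 by rewrite /v monomial0 mulr1.
  have v1 : v (unit_mi i) = h * c' (unit_mi i).
    by rewrite /v -[X in monomial _ X]mulr1n monomial_unit yi eqxx mulrC.
  have us := has_sumD (has_sumD vs (has_sumN (has_sum1 0 (v 0))))
    (has_sumN (has_sum1 (unit_mi i) (v (unit_mi i)))).
  rewrite v0 v1 in us; apply: has_sum_le_norm us _ => s us.
  apply: (@le_trans _ _ ((`|h| / delta) ^+ 2 * \sum_(b <- s) `|c' b| * pweight delta b)); last first.
    by rewrite ler_wpM2l ?exprn_ge0 ?divr_ge0// ?(ltW delta0)// c'M'.
  rewrite mulr_sumr; apply: ler_sum => b _.
  have hd2 : 0 <= (`|h| / delta) ^+ 2 by rewrite exprn_ge0 ?divr_ge0 ?(ltW delta0).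
  have pd0 : 0 <= pweight delta b by rewrite exprn_ge0// ltW.
  have rhs0 : 0 <= (`|h| / delta) ^+ 2 * (`|c' b| * pweight delta b).
    by rewrite mulr_ge0// mulr_ge0.
  have unz : unit_mi i != 0 :> mi.
    by apply/eqP => /ffunP/(_ i); rewrite unit_miE eqxx mi0.
  have [b0|b0] := eqVneq b 0.
    by rewrite b0 eq_sym (negPf unz) v0 subr0 subrr normr0 -b0.
  have [b1|b1] := eqVneq b (unit_mi i); first by rewrite b1 v1 !subr0 subrr normr0 -b1.
  rewrite !subr0 /v normrM mulrCA ler_wpM2l//.
  have [bi|/existsNP[j /not_implyP[ji bj]]] := pselect (forall j, j != i ->
    b j = 0%N); last first.
    rewrite /monomial (bigD1 j)//= yi (negPf ji) mulr0n expr0n;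
      move/eqP/negPf: bj => ->.
    by rewrite mul0r normr0 mulr_ge0.
  have bE : b = unit_mi i *+ b i.
    apply/ffunP => j; rewrite miMn unit_miE; case: (eqVneq j i) => [->|ji];
      first by rewrite mul1n.
    by rewrite mul0n bi.
  have b2 : (1 < b i)%N.
    case: (b i) bE => [|[|k]] bE //; first by rewrite bE mulr0n eqxx in b0.
    by rewrite bE mulr1n eqxx in b1.
  rewrite {1}bE monomial_unit yi eqxx mulr1n normrX /pweight {2}bE weightMn weight_unit mul1n.
  rewrite -(subnK b2) !exprD expr_div_n.
  have -> : `|h| ^+ 2 / delta ^+ 2 * (delta ^+ (b i - 2) * delta ^+ 2) =
    delta ^+ (b i - 2) * `|h| ^+ 2.
    by field; rewrite gt_eqF.
  by rewrite ler_wpM2r ?exprn_ge0// lerXn2r ?nnegrE// ltW.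
apply: cvg_lim => //; apply/cvgrPdist_le => e e0.
near=> h.
have h0 : h != 0 by near: h; exact: nbhs_dnbhs_neq.
have hd : `|h| <= delta by near: h; exact: dnbhs0_le.
(* [M' + 1] replaces [M'] to keep the denominator positive. *)
have he : `|h| <= e * delta ^+ 2 / (M' + 1).
  near: h; apply: dnbhs0_le; rewrite divr_gt0 ?mulr_gt0 ?exprn_gt0//.
  by rewrite ltr_wpDl.
rewrite /= [h *: _ + x]addrC c'0.
have -> : c' (unit_mi i) - h^-1 *: (sev c (x + h *: delta_mx ord0 i) - c' 0) =
   - (h^-1 * (sev c (x + h *: delta_mx ord0 i) - c' 0 - h * c' (unit_mi i))).
  by rewrite /GRing.scale /=; field.
rewrite normrN normrM normrV ?unitfE// ler_pdivrMl ?normr_gt0//.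
apply: le_trans (key _ hd) _; rewrite expr_div_n expr2 -!mulrA ler_wpM2l//.
rewrite mulrCA [leLHS]mulrC ler_pdivrMr ?exprn_gt0//.
move: he; rewrite ler_pdivlMr ?ltr_wpDl//.
have hn : 0 <= `|h| by [].
by move=> ?; apply: le_trans (_ : `|h| * (M' + 1) <= _) => //;
  rewrite ler_wpM2l// lerDl.
Unshelve. all: by end_near.
Qed.

(** Induction on the degree of the coefficient: the partial derivatives of the zero function vanish
    on a smaller box, and [sderiv] lowers the degree. The induction is general in [rho], [e] and
    [c], which all change. *)
Lemma sev_eq0 (rho e : R) c M : 0 < rho -> 0 < e -> bnd (pweight rho) c M ->
  (forall x, (forall i, `|x ord0 i| < e) -> sev c x = 0) -> c = 0.
Proof.
move=> rho0 e0 cM c0; apply/funext => a; rewrite ser0.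
elim: {a}(weight (fun=> 1%N) a) {-2}a (erefl (weight (fun=> 1%N) a)) rho e c M rho0 e0 cM c0
  => [|k IH] a wa rho e c M rho0 e0 cM c0.
  have -> : a = 0.
    by apply/ffunP => i; apply/eqP; rewrite mi0 -leqn0 -wa leq_weight.
  by rewrite -sev_at0 c0// => i; rewrite mxE normr0.
have [i ai] : exists i, (0 < a i)%N.
  apply: contrapT => /forallNP ai.
  suff : weight (fun=> 1%N) a = 0%N by rewrite wa.
  by rewrite /weight big1// => i _; have /negP := ai i; rewrite -eqn0Ngt => /eqP ->.
have ue : mi_le (unit_mi i) a by rewrite mi_le_unit.
pose e' := Num.min e (rho / 2).
have r2 : 0 < rho / 2 by rewrite divr_gt0.
have e'0 : 0 < e' by rewrite lt_min e0.
have d0 x : (forall i, `|x ord0 i| < e') -> sev (sderiv i c) x = 0.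
  move=> xe; rewrite -(@partial_sev rho (rho / 2) _ M)//; last first.
    move=> j; have := xe j; rewrite lt_min => /andP[_ xj].
    by rewrite {2}(splitr rho) lerD2r ltW.
  rewrite /partial (@near_eq_derive _ _ _ _ (cst 0)) ?derive_cst//.
  have xe' : ball (0 : 'rV[R]_n) e' x by apply/ball0_rowP.
  have := open_nbhs_nbhs (conj (ball_open (0 : 'rV[R]_n) e') xe').
  apply: filterS => y /ball0_rowP ye; apply: c0 => j.
  by have := ye e'0 j; rewrite lt_min => /andP[].
have := IH (mi_sub a (unit_mi i)) _ _ _ _ _ r2 e'0 (bnd_sderiv_half i rho0 cM) d0.
rewrite weight_sub// wa weight_unit subn1 => /(_ erefl).
by rewrite /sderiv mi_subK// => /eqP; rewrite mulrn_eq0 => /eqP.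
Qed.

Lemma analytic_sev (rho : R) c M x : bnd (pweight rho) c M ->
  (forall i, `|x ord0 i| < rho) -> 0 < rho -> analytic_at (sev c) x.
Proof.
move=> cM xr rho0.
have [delta delta0 xd] : exists2 delta, 0 < delta & forall i,
  `|x ord0 i| + delta <= rho.
  exists (rho - \big[Num.max/0]_i `|x ord0 i|).
    rewrite subr_gt0; elim/big_ind : _ => // u v ur vr; by rewrite gt_max ur vr.
  by move=> i; rewrite addrCA gerDl subr_le0 le_bigmax_cond.
have [c' [M' [_ c'y _]]] := recenter delta0 cM xd.
exists c', delta; split=> // y /(ball_rowP _ _ delta0) xy.
have := c'y (y - x); rewrite [x + _]addrC subrK; apply => i.
by rewrite !mxE -normrN opprB ltW.
Qed.

End Derivatives.

(** * Application to the Pham form *)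

Section Assembly.
Variables (R : realType) (n : nat).
Local Notation S := (series 'I_n R).
Implicit Types (x y : 'rV[R]_n) (f g c : S).

Lemma bnd_pweight_le (K : finType) (rho rho' M : R) (c : series K R) :
  0 <= rho -> rho <= rho' ->
  bnd (pweight rho') c M -> bnd (pweight rho) c M.
Proof.
move=> r0 rr; apply: bnd_leW => a; rewrite /pweight lerXn2r// nnegrE//.
exact: le_trans rr.
Qed.

(** Summability at the single point with all coordinates [e / 2] is a bound on the weighted norm of
    radius [e / 2]; the half keeps this point inside the open ball. *)
Lemma analytic_at0_series (w : 'rV[R]_n -> R) : analytic_at w 0 ->
  exists c rho M, [/\ 0 < rho, bnd (pweight rho) c M &
    forall x, (forall i, `|x ord0 i| <= rho) -> w x = sev c x].
Proof.
move=> [c [e [e0 ce]]].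
have e2 : 0 < e / 2 by rewrite divr_gt0.
have e2e : e / 2 < e by rewrite ltr_pdivrMr// ltr_pMr// ltr1n.
have cx x : (forall i, `|x ord0 i| <= e / 2) ->
    has_sum (fun a => c a * monomial x a) (w x).
  move=> xe; have := ce x; rewrite subr0; apply; apply/ball0_rowP => // i.
  exact: le_lt_trans e2e.
have [|sM _] := cx (const_mx (e / 2)).
  by move=> i; rewrite mxE ger0_norm// ltW.
have [M cM] := summable_bound sM.
exists c, (e / 2), M; split=> // [s us|x xe].
  apply: le_trans (cM _ us); apply: ler_sum => a _.
  by rewrite monomial_const normrM (ger0_norm (exprn_ge0 _ (ltW e2))).
by rewrite (sev_uniq (cx _ xe)).
Qed.

Lemma analytic_form_series (w : one_form R n) : (forall i, analytic_at (fun x =>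
  w x ord0 i) 0) ->
  exists (c : 'I_n -> S) rho M, [/\ 0 < rho, forall i, bnd (pweight rho) (c i) M &
    forall i x, (forall i, `|x ord0 i| <= rho) -> w x ord0 i = sev (c i) x].
Proof.
move=> wi.
have /choice[p pP] : forall i, exists p : S * (R * R), [/\ 0 < p.2.1,
    bnd (pweight p.2.1) p.1 p.2.2 & forall x, (forall i, `|x ord0 i| <= p.2.1) ->
    w x ord0 i = sev p.1 x].
  by move=> i; have [c [rho [M H]]] := analytic_at0_series (wi i); exists (c, (rho, M)).
pose rho := \big[Num.min/1]_i (p i).2.1.
have rho0 : 0 < rho.
  rewrite /rho; elim/big_ind : _ => // [u v u0 v0|i _]; first by rewrite lt_min u0.
  by have [] := pP i.
have rho_le i : rho <= (p i).2.1 by rewrite bigmin_le_cond.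
exists (fun i => (p i).1), rho, (\sum_i (p i).2.2); split=> // [i|i x xr].
  have [_ pb _] := pP i; apply: bnd_pweight_le (rho_le i) _; first exact: ltW.
  apply: bnd_le pb; rewrite (bigD1 i)//= lerDl; apply: sumr_ge0 => j _.
  by have [_ /bnd_ge0] := pP j.
by have [_ _ ->//] := pP i => j; exact: le_trans (rho_le i).
Qed.

Lemma bnd_poly (T : finType) (pr : pred T) (rho : R) (b : T -> {ffun 'I_n ->
  nat}) : 0 <= rho ->
  exists M, bnd (pweight rho) (\sum_(j | pr j) smono R (b j)) M.
Proof.
move=> r0; exists (\sum_(j | pr j) pweight rho (b j)).
have W0 a : 0 <= pweight rho a by rewrite exprn_ge0.
by apply: bnd_sum => // j _; exact: bnd_smono.
Qed.

Lemma sev_pham r m x : sev (pham_series R m (fun j : 'I_n =>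
  (j < r)%N)) x = pham r m.+1 x.
Proof.
rewrite /pham_series /pham.
pose rho : R := \sum_i `|x ord0 i|.
have xr i : `|x ord0 i| <= rho.
  by rewrite /rho (bigD1 i)//= lerDl sumr_ge0.
have r0 : 0 <= rho by exact: sumr_ge0.
have W0 (a : {ffun 'I_n -> nat}) : 0 <= pweight rho a by rewrite exprn_ge0.
suff [_ //] : (exists M,
  bnd (pweight rho) (\sum_(i < n | (i < r)%N) smono R (unit_mi i *+ m.+1)) M)
  /\ sev (\sum_(i < n | (i < r)%N) smono R (unit_mi i *+ m.+1)) x =
    \sum_(j < n | (j < r)%N) x ord0 j ^+ m.+1.
elim/big_rec2 : _ => [|i u f ir [[M fM] IH]].
  split; first by exists 0; exact: bnd0.
  by apply: sev_uniq; have := has_sum0 R {ffun 'I_n -> nat}; congr has_sum;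
    apply/funext => a; rewrite mul0r.
split; first by exists (pweight rho (unit_mi i *+ m.+1) + M); apply: bndD => //;
  exact: bnd_smono.
by rewrite (sevD (bnd_smono W0 _) fM)// IH sev_smono monomial_unit.
Qed.

Lemma sevB (rho M N : R) f g x : bnd (pweight rho) f M -> bnd (pweight rho) g N ->
  (forall i, `|x ord0 i| <= rho) -> sev (f - g) x = sev f x - sev g x.
Proof.
by move=> fM gN xr; rewrite (sevD fM (bndN gN) xr) (sevN gN xr).
Qed.

(** [P theta g] starts in degree [m+1], so degree [m] sees only [dP] and the constant term of [g].
    This will show that the first integral is not constant. *)
Lemma omega_coef m (pr : pred 'I_n) (th : 'I_n -> S) g i : pr i ->
  (omega_series m pr th i * g) (unit_mi i *+ m) = g 0 *+ m.+1.
Proof.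
move=> pri; rewrite /omega_series mulrDl serD.
have -> : sderiv i (pham_series R m pr) = smono R (unit_mi i *+ m) *+ m.+1.
  rewrite /pham_series sderiv_sum (bigD1 i)//= sderiv_smono_unit eqxx big1 ?addr0//.
  by move=> j /andP[_ /negPf ji]; rewrite sderiv_smono_unit eq_sym ji.
rewrite mulrnAl serMn smonoM mi_subn.
have -> : mi_le (unit_mi i *+ m) (unit_mi i *+ m) by apply/mi_leP.
suff : ord (fun=> 1%N) m.+1 (pham_series R m pr * th i * g).
  by move=> ->; rewrite ?addr0// weightMn weight_unit mul1n.
rewrite -mulrA -[m.+1]addn0; apply: ordM => //; apply: ord_sum => j _.
by apply: ord_smono; rewrite weightMn weight_unit mul1n.
Qed.

End Assembly.

Theorem theorem2 (R : realType) (n r d : nat)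
    (hn : (3 <= n)%N) (hr : (3 <= r <= n)%N)
    (U : set 'rV[R]_n) (hU : open U) (hU0 : U 0)
    (wt : one_form R n) (hwt : analytic_form_on U wt)
    (hint : integrable_form_on U (pham_form r d wt))
    (hd : exists p s : nat, prime p /\ d = (p ^ s)%N) :
  exists V : set 'rV[R]_n, [/\ open V, V 0, V `<=` U &
    exists f : 'rV[R]_n -> R,
      analytic_first_integral_on V (pham_form r d wt) f].
Proof.
have [m dE] : exists m, d = m.+1.
  have [p [s [pp ->]]] := hd; exists (p ^ s).-1.
  by rewrite prednK// expn_gt0 prime_gt0.
rewrite {}dE {hd d} in hint *.
have [r3 rn] := andP hr.
pose pr (j : 'I_n) := (j < r)%N.
pose i1 : 'I_n := Ordinal (leq_trans (isT : 0 < 3)%N hn).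
pose i2 : 'I_n := Ordinal (leq_trans (isT : 1 < 3)%N hn).
pose i3 : 'I_n := Ordinal (leq_trans (isT : 2 < 3)%N hn).
have pr1 : pr i1 by rewrite /pr (leq_trans _ r3).
have pr2 : pr i2 by rewrite /pr (leq_trans _ r3).
have pr3 : pr i3 by rewrite /pr (leq_trans _ r3).
have [th [rho0 [Mt [rho0_gt0 thb thE]]]] := analytic_form_series (fun i => hwt i 0 hU0).
pose P := pham_series R m pr; pose om := omega_series m pr th.
have [e e0 eU] : exists2 e : R, 0 < e & ball 0 e `<=` U.
  have := open_nbhs_nbhs (conj hU hU0); rewrite -nbhs_ballE => -[e e0 eU].
  by exists e.
have Pb (rho : R) : 0 <= rho -> exists M, bnd (pweight rho) P M by move=> ?;
  exact: bnd_poly.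
have W0 (rho : R) : 0 <= rho -> forall a : {ffun 'I_n -> nat}, 0 <= pweight rho a.
  by move=> h a; rewrite exprn_ge0.
have WD (rho : R) : 0 <= rho -> forall a b : {ffun 'I_n ->
  nat}, pweight rho (a + b) <= pweight rho a * pweight rho b :> R.
  by move=> h a b; rewrite /pweight weightD exprD.
have r2 : 0 < rho0 / 2 by rewrite divr_gt0.
have half_le : rho0 / 2 <= rho0 by rewrite ler_pdivrMr//
  ler_peMr ?(ltW rho0_gt0)// ler1n.
have [MP PM] := Pb rho0 (ltW rho0_gt0).
have PMh : bnd (pweight (rho0 / 2)) P MP by apply: bnd_pweight_le PM => //; exact: ltW.
have thbh i : bnd (pweight (rho0 / 2)) (th i) Mt by apply: bnd_pweight_le (thb i) => //; exact: ltW.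
have dPb i := bnd_sderiv_half i rho0_gt0 PM.
have Pthb i : bnd (pweight (rho0 / 2)) (P * th i) (MP * Mt).
  by apply: bndM => //; [apply: W0|apply: WD]; exact: ltW.
have omb i : bnd (pweight (rho0 / 2)) (om i) (rho0^-1 * MP + MP * Mt).
  by apply: bndD => //; apply: W0; exact: ltW.
have pham_sev : pham r m.+1 = sev P by apply/funext => x; rewrite sev_pham.
have omE i (x : 'rV[R]_n) : (forall j, `|x ord0 j| <= rho0 / 2) ->
  pham_form r m.+1 wt x ord0 i = sev (om i) x.
  move=> xr.
  have xr0 j : `|x ord0 j| <= rho0.
    by apply: le_trans (xr j) _; exact: half_le.
  rewrite /pham_form !mxE thE// pham_sev.
  rewrite (@partial_sev _ _ rho0 (rho0 / 2) _ MP)// => [|j]; last first.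
    by rewrite [leRHS](splitr rho0) lerD2r.
  rewrite /om /omega_series (sevD (dPb i) (Pthb i))// (sevM (PMh) (thbh i))//.
(* Integrability is given at the points of [U] but is used as an identity of power series; [sev_eq0]
   translates. The second halving of the radius pays for the derivatives of [omega]. *)
have integrable i j k : wedge12s om (fun i j =>
  sderiv i (om j) - sderiv j (om i)) i j k = 0.
  have r4 : 0 < rho0 / 2 / 2 by rewrite divr_gt0.
  have r4le : rho0 / 2 / 2 <= rho0 / 2 by rewrite ler_pdivrMr//
    ler_peMr ?(ltW r2)// ler1n.
  have om4 a : bnd (pweight (rho0 / 2 / 2)) (om a) (rho0^-1 * MP + MP * Mt).
    by apply: bnd_pweight_le (omb a) => //; exact: ltW.
  have dom4 a b := bnd_sderiv_half a r2 (omb b).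
  have W4 : forall a : {ffun 'I_n -> nat}, 0 <=
    pweight (rho0 / 2 / 2) a by apply: W0; exact: ltW.
  have WD4 := WD _ (ltW r4).
  have ddb a b := bndB W4 (dom4 a b) (dom4 b a).
  have prodb a b c := bndM W4 WD4 (om4 a) (ddb b c).
  apply: (sev_eq0 (rho := rho0 / 2 / 2) (e := Num.min e (rho0 / 2 / 2))
    r4 _ (bndD W4 (bndB W4 (prodb i j k) (prodb j i k)) (prodb k i j))).
    by rewrite lt_min e0.
  move=> x xe.
  have xe1 a : `|x ord0 a| < e by have := xe a; rewrite lt_min => /andP[].
  have xe2 a : `|x ord0 a| < rho0 / 2 / 2 by have := xe a; rewrite lt_min => /andP[].
  have xe2' a : `|x ord0 a| <= rho0 / 2 / 2 by exact: ltW.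
  have dE a b : partial a (fun y => pham_form r m.+1 wt y ord0 b) x =
    sev (sderiv a (om b)) x.
    rewrite -(@partial_sev _ _ (rho0 / 2) (rho0 / 2 / 2) _ _ _ _ r4 (omb b));
      last first.
      by move=> l; rewrite [leRHS](splitr (rho0 / 2)) lerD2r.
    (* The form agrees with its series only on a box, but a derivative at an interior point is
       local. *)
    apply: near_eq_derive.
    have xb : ball (0 : 'rV[R]_n) (rho0 / 2) x.
      by apply/ball0_rowP => // l; exact: lt_le_trans (xe2 l) r4le.
    have := open_nbhs_nbhs (conj (ball_open (0 : 'rV[R]_n) (rho0 / 2)) xb).
    by apply: filterS => y /ball0_rowP yr; apply: omE => l; apply: ltW; exact: yr.
  have prodE a b c : sev (om a * (sderiv b (om c) - sderiv c (om b))) x =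
      pham_form r m.+1 wt x ord0 a * diff1 (pham_form r m.+1 wt) x b c.
    rewrite (sevM (om4 a) (ddb b c))// (sevB (dom4 b c) (dom4 c b))//
      [diff1 _ _ b c]mxE !dE omE//.
    by move=> l; exact: le_trans (xe2' l) r4le.
  rewrite (sevD (bndB W4 (prodb i j k) (prodb j i k)) (prodb k i j))//.
  rewrite (sevB (prodb i j k) (prodb j i k))// !prodE.
  by apply: hint; apply: eU; apply/ball0_rowP.
have n12 : i1 != i2 by [].
have n13 : i1 != i3 by [].
have n23 : i2 != i3 by [].
have [rho [M [f [g [rho_gt0 fM gM Df g0]]]]] :=
  first_integral_series pr1 pr2 pr3 n12 n13 n23 rho0_gt0 thb integrable.
(* Keeps the box inside [U], inside the domain where [omega] equals its series, and at distance
   [rho / 2] from the boundary of that of [f]. *)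
pose del := Num.min e (Num.min (rho0 / 2) (rho / 2)).
have del0 : 0 < del by rewrite !lt_min e0 !divr_gt0.
pose rd := Num.min (rho0 / 2) (rho / 2).
have rd0 : 0 < rd by rewrite lt_min r2 divr_gt0.
have omd i : bnd (pweight rd) (om i) (rho0^-1 * MP + MP * Mt).
  by apply: bnd_pweight_le (omb i); [exact: ltW|rewrite ge_min lexx].
have gd : bnd (pweight rd) g M.
  apply: bnd_pweight_le gM; first exact: ltW.
  by rewrite ge_min; apply/orP; right; rewrite ler_pdivrMr//
    ler_peMr ?(ltW rho_gt0)// ler1n.
have partial_f i (x : 'rV[R]_n) : (forall j, `|x ord0 j| < del) ->
    partial i (sev f) x = pham_form r m.+1 wt x ord0 i * sev g x.
  move=> xd.
  have xd1 j : `|x ord0 j| < rho0 / 2 by have := xd j; rewrite !lt_min =>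
    /andP[_ /andP[]].
  have xd2 j : `|x ord0 j| < rho / 2 by have := xd j; rewrite !lt_min =>
    /andP[_ /andP[]].
  rewrite (@partial_sev _ _ rho (rho / 2) _ M)//; last 2 first.
  - by rewrite divr_gt0.
  - by move=> j; rewrite [leRHS](splitr rho) lerD2r ltW.
  rewrite Df (sevM (omd i) gd) ?omE// => j; first exact: ltW.
  by rewrite le_min !ltW.
exists (ball 0 del); split.
- exact: ball_open.
- exact: ballxx.
- move=> x /ball0_rowP xd; apply: eU; apply/ball0_rowP => // i.
  by have := xd del0 i; rewrite lt_min => /andP[].
exists (sev f); split.
- move=> x /ball0_rowP xd; apply: (analytic_sev fM _ rho_gt0) => i.
  have := xd del0 i; rewrite !lt_min => /andP[_ /andP[_ xr]].
  by apply: lt_trans xr _; rewrite ltr_pdivrMr// mulr_natr mulr2n ltrDl.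
(* If [f] were constant near 0, then [g * omega = df] would vanish as a series, against the
   coefficient [(m+1) g(0) = m+1] of [x_1^m] in its first component. *)
- move=> fc.
  have [e1 e10 fe] : exists2 e1 : R, 0 < e1 & forall x : 'rV[R]_n, ball 0 e1 x ->
    sev f x = sev f 0.
    by have /nbhs_ballP[e1 e10 fe] := fc; exists e1.
  have omg0 : om i1 * g = 0.
    apply: (sev_eq0 (rho := rd) (e := Num.min e1 del) rd0 _
      (bndM (W0 _ (ltW rd0)) (WD _ (ltW rd0)) (omd i1) gd));
        first by rewrite lt_min e10.
    move=> x xe.
    have xd j : `|x ord0 j| < del by have := xe j; rewrite lt_min => /andP[].
    have xd1 j : `|x ord0 j| < rho0 / 2 by have := xd j;
      rewrite !lt_min => /andP[_ /andP[]].
    have xrd j : `|x ord0 j| <= rd.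
      by have := xd j; rewrite !lt_min => /andP[_ /andP[? ?]]; rewrite le_min !ltW.
    rewrite (sevM (omd i1) gd)// -omE => [|j]; last exact: ltW.
    rewrite -partial_f// /partial (@near_eq_derive _ _ _ _ (cst (sev f 0))) ?derive_cst//.
    have xb : ball (0 : 'rV[R]_n) e1 x.
      by apply/ball0_rowP => // j; have := xe j; rewrite lt_min => /andP[].
    have := open_nbhs_nbhs (conj (ball_open (0 : 'rV[R]_n) e1) xb).
    by apply: filterS => y; exact: fe.
  have := omega_coef m th g pr1; rewrite -/om omg0 g0 ser0.
  by move=> /esym/eqP; rewrite pnatr_eq0.
- move=> x /ball0_rowP xd; apply/matrixP => i j.
  rewrite [LHS]mxE [RHS]mxE ![diff0 _ _ _ _]mxE !partial_f; [by ring|exact: xd..].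
Qed.
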